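(* Let $(G_i)_{i\in I}$ be a family of finite groups, indexed by an arbitrary set $I$, and let $G=\bigoplus_{i\in I}G_i$ be their restricted direct product. Then the following are equivalent: (i) every maximal ideal in $\mathrm{Z}\ell^1(G)$ has a bounded approximate identity; (ii) there is a finite subset $F\subset I$ such that, for each $i\in I\setminus F$ and each irreducible group character $\chi$ of $G_i$, we have $d_\chi\|\chi\|_1=|G_i|$; (iii) there exists a constant $M>0$ such that each maximal ideal in $\mathrm{Z}\ell^1(G)$ has a bounded approximate identity of norm $\le M$.
   Context: The restricted direct product $\bigoplus_{i\in I}G_i$ is the subgroup of $\prod_{i\in I}G_i$ consisting of all $(x_i)$ with $x_i=e_{G_i}$ for all but finitely many $i$, regarded as a discrete group. For a discrete group $G$, $\ell^1(G)$ is the convolution algebra with respect to counting measure and $\mathrm{Z}\ell^1(G)$ is its centre, a commutative unital Banach algebra. A group character of a finite group $H$ is the (unnormalized) trace $\chi$ of a finite-dimensional complex representation; its degree is $d_\chi=\chi(e)$, and $\|\chi\|_1=\sum_{x\in H}|\chi(x)|$. A bounded approximate identity for a commutative Banach algebra $J$ is a norm-bounded net $(h_\alpha)$ in $J$ with $h_\alpha f\to f$ in norm for all $f\in J$; it has norm $\le M$ if $\sup_\alpha\|h_\alpha\|\le M$. *)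

(* Defs.v *)
From HB Require Import structures.
From mathcomp Require Import all_boot all_order all_algebra all_fingroup.
From mathcomp Require Import mxrepresentation complex.
From mathcomp Require Import all_classical all_reals all_analysis.
From mathcomp.analysis Require Import showcase.summability.

Set Implicit Arguments.
Unset Strict Implicit.
Unset Printing Implicit Defensive.

Import Order.TTheory GRing.Theory Num.Theory.
Import numFieldNormedType.Exports.

Local Open Scope classical_set_scope.
Local Open Scope ring_scope.

Section RestrictedDirectProduct.
Variables (I : Type) (G : I -> finGroupType).
Local Open Scope group_scope.

Definition direct_prod : Type := forall i : I, G i.

HB.instance Definition _ := Choice.on direct_prod.

Definition direct_prod_one : direct_prod := fun=> 1.
Definition direct_prod_inv (x : direct_prod) : direct_prod :=
  fun i => (x i)^-1.
Definition direct_prod_mul (x y : direct_prod) : direct_prod :=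
  fun i => x i * y i.

Fact direct_prod_mulgA : associative direct_prod_mul.
Proof. by move=> x y z; apply: functional_extensionality_dep => i; apply: mulgA. Qed.

Fact direct_prod_mul1g : left_id direct_prod_one direct_prod_mul.
Proof. by move=> x; apply: functional_extensionality_dep => i; apply: mul1g. Qed.

Fact direct_prod_mulg1 : right_id direct_prod_one direct_prod_mul.
Proof. by move=> x; apply: functional_extensionality_dep => i; apply: mulg1. Qed.

Fact direct_prod_mulVg :
  left_inverse direct_prod_one direct_prod_inv direct_prod_mul.
Proof. by move=> x; apply: functional_extensionality_dep => i; apply: mulVg. Qed.

Fact direct_prod_mulgV :
  right_inverse direct_prod_one direct_prod_inv direct_prod_mul.
Proof. by move=> x; apply: functional_extensionality_dep => i; apply: mulgV. Qed.

HB.instance Definition _ := isGroup.Build direct_prod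
  direct_prod_mulgA direct_prod_mul1g direct_prod_mulg1
  direct_prod_mulVg direct_prod_mulgV.

Definition almost_trivial : {pred direct_prod} :=
  fun x => `[< finite_set [set i | x i <> 1] >].

Fact almost_trivial_group_closed : group_closed almost_trivial.
Proof.
split; first by apply/asboolP; rewrite (_ : [set i | _] = set0) // -subset0.
move=> x y /asboolP fx /asboolP fy; apply/asboolP.
apply: (@sub_finite_set _ _ ([set i | x i <> 1] `|` [set i | y i <> 1])).
  move=> i /= xy1; case: (pselect (x i = 1)) => x1; [right => y1 | by left].
  by apply: xy1; rewrite /= -[LHS]/(x i * (y i)^-1) x1 y1 mulgV.
by rewrite finite_setU.
Qed.

Record restricted_prod : Type := RestrictedProd {
  restricted_prod_val :> direct_prod;
  _ : restricted_prod_val \in almost_trivial }.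

HB.instance Definition _ := [isSub for restricted_prod_val].
HB.instance Definition _ := [Choice of restricted_prod by <:].
HB.instance Definition _ := SubChoice_isSubGroup.Build
  direct_prod almost_trivial restricted_prod almost_trivial_group_closed.

End RestrictedDirectProduct.

Section GroupAlgebra.
Variables (R : realType) (G : groupType).
Implicit Types (f g : G -> R[i]) (J K : set (G -> R[i])).

(* Elements of l^1(G) are represented by bare functions; [ell1] and [Zell1]
   are the carriers, and ideals are subsets of [Zell1]. *)
Definition ell1_norm f : \bar R :=
  \esum_(x in [set: G]) (ComplexField.Normc.normc (f x))%:E.

Definition ell1 : set (G -> R[i]) := [set f | (ell1_norm f < +oo)%E].

(* [summability.sum] is the unordered sum, i.e. the limit of the partial sums
   along the finite subsets of G; it converges for f and g in [ell1]. *)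
Definition convolution f g : G -> R[i] :=
  fun x => summability.sum (fun y => f y * g (y^-1 * x)%g : R[i]^o).

Definition Zell1 : set (G -> R[i]) :=
  [set f | ell1 f /\ forall g, ell1 g -> convolution f g = convolution g f].

Definition ideal J : Prop :=
  [/\ J `<=` Zell1,
      J (fun=> 0),
      forall (a : R[i]) f g, J f -> J g -> J (fun x => a * f x + g x) &
      forall f g, Zell1 f -> J g -> J (convolution f g)].

Definition maximal_ideal J : Prop :=
  [/\ ideal J, J <> Zell1 &
      forall K, ideal K -> J `<=` K -> K = J \/ K = Zell1].

Definition directed (A : Type) (le : A -> A -> Prop) : Prop :=
  [/\ inhabited A,
      forall a, le a a,
      forall a b c, le a b -> le b c -> le a c &
      forall a b, exists c, le a c /\ le b c].

Definition net_norm (A : Type) (h : A -> G -> R[i]) : \bar R :=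
  ereal_sup [set ell1_norm (h a) | a in [set: A]].

Definition approximate_identity J (A : Type) (le : A -> A -> Prop)
    (h : A -> G -> R[i]) : Prop :=
  [/\ directed le,
      forall a, J (h a) &
      forall f, J f -> forall e : R, 0 < e ->
        exists a0, forall a, le a0 a ->
          (ell1_norm (fun x => convolution (h a) f x - f x)%R < e%:E)%E].

Definition has_bai J : Prop :=
  exists (A : Type) (le : A -> A -> Prop) (h : A -> G -> R[i]),
    approximate_identity J le h /\ (net_norm h < +oo)%E.

Definition has_bai_of_norm_le (M : R) J : Prop :=
  exists (A : Type) (le : A -> A -> Prop) (h : A -> G -> R[i]),
    approximate_identity J le h /\ (net_norm h <= M%:E)%E.

End GroupAlgebra.

Definition irreducible_character (R : realType) (gT : finGroupType)
    (chi : gT -> R[i]) : Prop :=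
  exists (n : nat) (rG : mx_representation R[i] (setT_group gT) n),
    mx_irreducible rG /\ forall x, chi x = \tr (rG x).

(* Main.v *)
(** The characters of the centre of [l^1(G)] are the products
    [phi = (x) phi_i], where [phi_i] comes from a "spherical" function [f_i]
    on [G_i], i.e. an irreducible character divided by its degree; let [e_i]
    be the central idempotent of [G_i] attached to [f_i] and [N_i >= 1] its
    norm, so that [N_i = 1] is exactly [d_chi |chi|_1 = |G_i|].

    (i) => (ii).  There is a gap: [N_i] is [1] or at least [1 + 1/1024].
    Indeed, if [N_i] is close to [1] then [|f_i|] is close to [1] on a normal
    subgroup [K] carrying almost all the mass of [f_i]; a trace computation
    forces [|f_i| = 1] on [K], and then [e_i] and the idempotent [conj f_i 1_K / |K|]
    differ by an idempotent of norm less than [1], hence are equal.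
    If (ii) fails, choose [f_i] with [N_i <> 1] at infinitely many [i].  An
    approximate identity of [ker phi] bounded by [M] then yields
    [N_i1 ... N_in <= M + 2] for all finite sets of indices: pair
    [u * e_i1 * ... * e_in] with the product of the phases of the [f_i].

    (ii) => (iii).  A maximal ideal [J] is prime, and by Cayley-Hamilton each
    class function on [G_i] is congruent modulo [J] to a scalar; these scalars
    define spherical functions [f_i].  For a finite set [S] of indices let
    [E_S] be the product of the [e_i], [i] in [S].  Then [1 - E_S] is in [J],
    [g * E_S - phi(g) E_S] tends to [0], and a Neumann series shows
    that [phi] vanishes on [J].  So [1 - E_S] is an approximate identity,
    bounded by [1] plus the product of the orders of the exceptional [G_i]. *)
Require Import Defs.
From HB Require Import structures.
From mathcomp Require Import all_boot all_order all_algebra all_fingroup.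
From mathcomp Require Import mxrepresentation complex finmap.
From mathcomp Require Import all_classical all_reals all_analysis.
From mathcomp.analysis Require Import showcase.summability.
From mathcomp Require Import ring lra.

Set Implicit Arguments.
Unset Strict Implicit.
Unset Printing Implicit Defensive.

Import Order.TTheory GRing.Theory Num.Theory.
Import numFieldNormedType.Exports.
Local Open Scope ring_scope.

Local Notation normc := ComplexField.Normc.normc.

(** * The real-valued modulus on [R[i]] *)

Section NormC.
Variable R : realType.
Implicit Types x y z : R[i].

Lemma normcE z : `|z| = (normc z)%:C%C.
Proof. by case: z => a b; rewrite normc_def. Qed.

Lemma normc_ge0 z : 0 <= normc z.
Proof. by rewrite -lecR -normcE; apply: normr_ge0. Qed.

Lemma ler_normcD x y : normc (x + y) <= normc x + normc y.
Proof. exact: le_normcD. Qed.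

Lemma normcM x y : normc (x * y) = normc x * normc y.
Proof. exact: ComplexField.Normc.normcM. Qed.

Lemma normc0 : normc (0 : R[i]) = 0.
Proof. exact: ComplexField.Normc.normc0. Qed.

Lemma normc1 : normc (1 : R[i]) = 1.
Proof. exact: ComplexField.Normc.normc1. Qed.

Lemma normc_eq0 z : (normc z == 0) = (z == 0).
Proof.
apply/eqP/eqP => [/ComplexField.Normc.eq0_normc//|->]; exact: normc0.
Qed.

Lemma normcN z : normc (- z) = normc z.
Proof. exact: normcN. Qed.

Lemma normcBC x y : normc (x - y) = normc (y - x).
Proof. by rewrite -normcN opprB. Qed.

Lemma ler_normcB x y : normc (x - y) <= normc x + normc y.
Proof. by rewrite -(normcN y) ler_normcD. Qed.

Lemma normc_real (a : R) : normc a%:C%C = `|a|.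
Proof. by rewrite /= expr0n addr0 sqrtr_sqr. Qed.

Lemma normcV z : normc z^-1 = (normc z)^-1.
Proof. exact: ComplexField.Normc.normcV. Qed.

Lemma ler_normc_sum (I : Type) (s : seq I) (P : pred I) (F : I -> R[i]) :
  normc (\sum_(i <- s | P i) F i) <= \sum_(i <- s | P i) normc (F i).
Proof.
elim/big_rec2 : _ => [|i a b _ le_ba]; first by rewrite normc0.
by rewrite (le_trans (ler_normcD _ _)) // lerD2l.
Qed.

Lemma Re_le_normc z : `|complex.Re z| <= normc z.
Proof.
by case: z => a b /=; rewrite -sqrtr_sqr ler_wsqrtr // lerDl sqr_ge0.
Qed.

Lemma Im_le_normc z : `|complex.Im z| <= normc z.
Proof.
by case: z => a b /=; rewrite -sqrtr_sqr ler_wsqrtr // lerDr sqr_ge0.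
Qed.

Lemma normc_conj z : normc z^* = normc z.
Proof. by case: z => a b /=; rewrite sqrrN. Qed.

End NormC.

(** * Normalised irreducible characters of finite groups *)

Section NormC2.
Variable R : realType.
Implicit Types x y z : R[i].

Lemma mul_conjc z : z * conjc z = (normc z ^+ 2)%:C%C.
Proof.
case: z => a b /=; rewrite sqr_sqrtr ?addr_ge0 ?sqr_ge0 //.
by congr Complex; ring.
Qed.

Lemma normc_subsq x y : normc (x - y) ^+ 2 =
  normc x ^+ 2 + normc y ^+ 2 - 2 * complex.Re (x * conjc y).
Proof.
case: x y => a b [c e].
rewrite /= !sqr_sqrtr ?addr_ge0 ?sqr_ge0 //; ring.
Qed.

Lemma normc_sqD x y : normc (x + y) ^+ 2 <= 2 * normc x ^+ 2 + 2 * normc y ^+ 2.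
Proof.
have : normc (x + y) ^+ 2 <= (normc x + normc y) ^+ 2.
  by rewrite ler_sqr ?nnegrE ?addr_ge0 ?normc_ge0 // ler_normcD.
by have := sqr_ge0 (normc x - normc y); rewrite sqrrB sqrrD; lra.
Qed.

Lemma Re_le z : complex.Re z <= normc z.
Proof. exact: le_trans (ler_norm _) (Re_le_normc z). Qed.

Lemma Re_sum (I : finType) (P : pred I) (F : I -> R[i]) :
  complex.Re (\sum_(i | P i) F i) = \sum_(i | P i) complex.Re (F i).
Proof. by elim/big_rec2: _ => // i a b _ <-; case: (F i) b => [? ?] [? ?]. Qed.

Lemma Re_mulr (a : R) z : complex.Re (a%:C%C * z) = a * complex.Re z.
Proof. by case: z => b c /=; rewrite mul0r subr0. Qed.

End NormC2.

Section Spherical.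
Variables (R : realType) (H : finGroupType).
Local Notation C := R[i].
Implicit Types (f : H -> C) (x y z t : H).

(** These are the functions [chi / chi(1)] for [chi] irreducible, described by a functional
    equation: [sphM] makes [f] multiplicative on averages over conjugacy classes. In this form they
    can be read off a maximal ideal before any representation is at hand; [irr_char_spherical] and
    [spherical_irreducible_character] give the two directions of the correspondence. *)
Record spherical f : Prop := Spherical {
  sph1 : f 1%g = 1;
  sphV : forall x, f x^-1%g = conjc (f x);
  sphM : forall x y, \sum_t f (x * y ^ t)%g = #|H|%:R * (f x * f y) }.

Lemma cardH_neq0 : #|H|%:R != 0 :> C.
Proof. by rewrite pnatr_eq0 -lt0n; apply/card_gt0P; exists 1%g. Qed.

Section Theory.
Variable f : H -> C.
Hypothesis sf : spherical f.

(** Taking [x = 1] in [sphM] exhibits [f y] as the average of [f] over the conjugates of [y]. *)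
Lemma sph_class x t : f (x ^ t)%g = f x.
Proof.
have avg y : #|H|%:R * f y = \sum_s f (y ^ s)%g.
  have := sphM sf 1%g y; rewrite (sph1 sf) mul1r => <-.
  by apply: eq_bigr => s _; rewrite mul1g.
apply: (mulfI cardH_neq0); rewrite !avg.
rewrite [RHS](reindex_inj (mulgI t)) /=.
by apply: eq_bigr => s _; rewrite conjgM.
Qed.

Lemma sphC x y : f (x * y)%g = f (y * x)%g.
Proof. by rewrite -(sph_class (y * x)%g y) conjgE -mulgA mulKg. Qed.

(** Conjugating the summation variable leaves [a] unchanged, and averaging over these conjugations
    splits [f (x * y)] into [f x * f y] by [sphM]. *)
Lemma sph_classM (a : H -> C) x : (forall y t, a (y ^ t)%g = a y) ->
  \sum_y f (x * y)%g * a y = f x * \sum_y f y * a y.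
Proof.
move=> ac; apply: (mulfI cardH_neq0).
transitivity (\sum_t \sum_y f (x * y ^ t)%g * a y).
  rewrite mulr_natl -sumr_const; apply: eq_bigr => t _.
  rewrite (reindex_inj (conjg_inj t)) /=.
  by apply: eq_bigr => y _; rewrite ac.
rewrite exchange_big /= mulrA mulr_sumr; apply: eq_bigr => y _.
by rewrite -mulr_suml (sphM sf) !mulrA.
Qed.

(** At a point [y] of maximal modulus, [sphM] applied to [y^-1] and [y] gives [|f y|^2 <= |f y|]. *)
Lemma sph_le1 x : normc (f x) <= 1.
Proof.
pose m := [arg max_(i > 1%g) normc (f i)]%O.
have [y _ ymax] : extremum_spec >=%O xpredT (fun i => normc (f i)) m by apply: arg_maxP.
apply: le_trans (ymax x isT) _.
have H0 : 0 < #|H|%:R :> R by rewrite ltr0n; apply/card_gt0P; exists 1%g.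
have : normc (#|H|%:R * (f y^-1%g * f y)) <= #|H|%:R * normc (f y).
  rewrite -(sphM sf) (le_trans (ler_normc_sum _ _ _)) //.
  apply: (@le_trans _ _ (\sum_(t : H) normc (f y))).
    by apply: ler_sum => t _; apply: ymax.
  by rewrite sumr_const mulr_natl.
rewrite !normcM (sphV sf) normc_conj.
have -> : normc (#|H|%:R : C) = #|H|%:R.
  by rewrite -(rmorph_nat (real_complex R)) normc_real normr_nat.
rewrite ler_pM2l //; have := normc_ge0 (f y); move: (normc _) => a a0 aa.
by rewrite leNgt; apply/negP => a1; move: aa; nra.
Qed.

(** For [f = chi / n] with [chi] irreducible of degree [n] this is [|H| / n^2], by [irr_char_sq]. *)
Definition sph_sq : R := \sum_y normc (f y) ^+ 2.

Lemma sph_sq_ge1 : 1 <= sph_sq.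
Proof.
rewrite /sph_sq (bigD1 1%g) //= (sph1 sf) normc1 expr1n lerDl.
by apply: sumr_ge0 => x _; apply: sqr_ge0.
Qed.

Lemma sph_sq_gt0 : 0 < sph_sq. Proof. exact: lt_le_trans ltr01 sph_sq_ge1. Qed.

Lemma sph_conv x : \sum_y f (x * y)%g * f y^-1%g = f x * sph_sq%:C%C.
Proof.
rewrite (sph_classM (a := fun y => f y^-1%g)); last first.
  by move=> y t; rewrite -conjVg sph_class.
congr (_ * _); rewrite rmorph_sum; apply: eq_bigr => y _.
by rewrite (sphV sf) mul_conjc.
Qed.

(** Expanding the squares leaves a cross term that [sph_conv] evaluates. *)
Lemma sph_translate x (w : C) : normc w = 1 ->
  \sum_z normc (f (x * z)%g - w * f z) ^+ 2 =
  sph_sq * (2 - 2 * complex.Re (conjc w * f x)).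
Proof.
move=> w1; under eq_bigr do rewrite normc_subsq normcM w1 mul1r rmorphM /=.
rewrite sumrB big_split /=.
have -> : \sum_i normc (f (x * i)%g) ^+ 2 = sph_sq.
  by rewrite /sph_sq [RHS](reindex_inj (mulgI x)).
rewrite -/sph_sq -mulr_sumr -Re_sum.
rewrite (_ : \sum_i _ = sph_sq%:C%C * (conjc w * f x)).
  by rewrite Re_mulr; ring.
rewrite mulrCA [sph_sq%:C%C * _]mulrC -sph_conv mulr_sumr; apply: eq_bigr => z _.
by rewrite (sphV sf) mulrCA.
Qed.

Lemma sph_phase x : exists2 w : C, normc w = 1 & complex.Re (conjc w * f x) = normc (f x).
Proof.
have [fx0|fx0] := eqVneq (f x) 0.
  by exists 1; rewrite ?normc1 // fx0 mulr0 normc0.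
have n0 : normc (f x) != 0 by rewrite normc_eq0.
exists ((normc (f x))^-1%:C%C * f x).
  by rewrite normcM normc_real ger0_norm ?invr_ge0 ?normc_ge0 // mulVf.
rewrite rmorphM /= oppr0 -/(real_complex _ _) -mulrA Re_mulr mulrC.
rewrite [_ * f x]mulrC mul_conjc /=.
by rewrite expr2 mulfK.
Qed.

(* [1 - |f x|] is half the squared distance, up to a phase, between the
   normalised [f] and its translate by [x]. *)
Lemma sph_almost_mult x y :
  1 - normc (f (x * y)%g) <= 2 * (1 - normc (f x)) + 2 * (1 - normc (f y)).
Proof.
have [w w1 wx] := sph_phase x; have [v v1 vy] := sph_phase y.
have wv1 : normc (w * v) = 1 by rewrite normcM w1 v1 mul1r.
have eqxy := sph_translate (x * y)%g wv1.
have eqx := sph_translate x w1; have eqy := sph_translate y v1.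
have : \sum_z normc (f (x * y * z)%g - w * v * f z) ^+ 2 <=
  2 * (\sum_z normc (f (x * z)%g - w * f z) ^+ 2) +
  2 * (\sum_z normc (f (y * z)%g - v * f z) ^+ 2).
  rewrite [X in _ <= 2 * X + _](reindex_inj (mulgI y)) /=.
  rewrite !mulr_sumr -big_split /=; apply: ler_sum => z _.
  have -> : f (x * y * z)%g - w * v * f z =
    (f (x * (y * z))%g - w * f (y * z)%g) + w * (f (y * z)%g - v * f z).
    by rewrite mulgA; ring.
  by apply: le_trans (normc_sqD _ _) _; rewrite [normc (w * _)]normcM w1 mul1r.
rewrite eqxy eqx eqy wx vy (mulrCA 2 sph_sq) (mulrCA 2 sph_sq) -mulrDr.
rewrite ler_pM2l ?sph_sq_gt0 //.
have := Re_le (conjc (w * v) * f (x * y)%g).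
rewrite normcM normc_conj wv1 mul1r; lra.
Qed.

End Theory.
End Spherical.

Section TraceIdempotent.
Variable F : fieldType.

(** Factor [A] as [col_base A *m row_base A]. Cancelling the one-sided inverses of both factors in
    [A *m A = A] shows that the product in the other order is the identity of size [\rank A], and
    the trace is the same for both orders. *)
Lemma mxtrace_idem n (A : 'M[F]_n) : A *m A = A -> \tr A = (\rank A)%:R.
Proof.
move=> AA; rewrite -{1}(mulmx_base A) mxtrace_mulC.
suff -> : row_base A *m col_base A = 1%:M by rewrite mxtrace1.
have [/row_freeP[B rB] /row_fullP[D Dc]] := (row_base_free A, col_base_full A).
move: AA rB Dc; move: (mulmx_base A).
move: (\rank A) (row_base A) (col_base A) B D => k r c B D <- AA rB Dc.
have := congr1 (fun M => D *m M *m B) AA.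
by rewrite /= !mulmxA Dc mul1mx -!mulmxA rB mulmx1 => ->.
Qed.

End TraceIdempotent.

(** * The gap: a central idempotent of norm below 1 + 1/1024 has norm 1 *)

Section Gap.
Variables (R : realType) (H : finGroupType) (f : H -> R[i]).
Hypothesis sf : spherical f.
Local Notation C := R[i].

Let Q : R := sph_sq f.
Let S : R := \sum_x normc (f x).
Let Q0 : 0 < Q := sph_sq_gt0 sf.

(** The norm in [l^1(H)] of the central idempotent [conj f / sph_sq f]; [irr_char_sph_norm] relates
    the value 1 to the condition on degrees. *)
Definition sph_norm : R := (sph_sq f)^-1 * \sum_x normc (f x).

Hypothesis small : sph_norm < 1 + 1024^-1.

(** The threshold is chosen for repeated use of [sph_almost_mult]: the defect [1 - |f|] is at most
    1/64 on [A], hence at most 1/16 on products of two elements and at most 1/4 on products of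
    four. *)
Let A : {set H} := [set x | 1 - 64^-1 <= normc (f x)].

Let f01 x : 0 <= normc (f x) <= 1.
Proof. by rewrite normc_ge0 sph_le1. Qed.

(** [S - Q] is the sum of [|f| - |f|^2], whose terms are at least [|f| / 64] off [A]. As [S - Q] is
    below [Q / 1024], the mass off [A] is at most [64 * Q / 1024]. *)
Let offA : \sum_(x | x \notin A) normc (f x) <= Q / 16.
Proof.
have SQ : S < Q * (1 + 1024^-1).
  by move: small; rewrite /sph_norm mulrC -/Q -/S ltr_pdivrMr // mulrC.
have : \sum_(x | x \notin A) 64^-1 * normc (f x) <= S - Q.
  rewrite /S /Q /sph_sq -sumrB [leRHS](bigID (mem A)) /= -[leLHS]add0r lerD //.
    by apply: sumr_ge0 => x _; have /andP[] := f01 x; nra.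
  apply: ler_sum => x; rewrite inE -ltNge; have /andP[] := f01 x.
  move: (normc _) => a; nra.
by rewrite -mulr_sumr; move: SQ; lra.
Qed.

Let offA2 : \sum_(x | x \notin A) normc (f x) ^+ 2 <= Q / 16.
Proof.
apply: le_trans offA; apply: ler_sum => x _; have /andP[] := f01 x; nra.
Qed.

Let cardA : 15 / 16 * Q <= #|A|%:R.
Proof.
have : Q <= #|A|%:R + Q / 16; last by lra.
rewrite {1}/Q /sph_sq (bigID (mem A)) /= lerD //.
rewrite -sumr_const; apply: ler_sum => x _; have /andP[] := f01 x; nra.
Qed.

Let A1 : 1%g \in A.
Proof. by rewrite inE (sph1 sf) normc1; lra. Qed.

Let AV x : x \in A -> x^-1%g \in A.
Proof. by rewrite !inE (sphV sf) normc_conj. Qed.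

Let AJ x t : (x ^ t \in A)%g = (x \in A).
Proof. by rewrite !inE (sph_class sf). Qed.

(* Otherwise [|f|], which is at least [3/4] on [x y z A], would have little
   mass there, as that set avoids [A]. *)
Let AAA x y z : x \in A -> y \in A -> z \in A -> (x * y * z \in A * A)%g.
Proof.
rewrite !inE => xA yA zA; set g := (x * y * z)%g.
have [[a aA gaA]|noA] := pselect (exists2 a, a \in A & (g * a)%g \in A).
  by apply/mulsgP; exists (g * a)%g a^-1%g; rewrite ?mulgK // AV.
exfalso.
have : \sum_(a in A) normc (f (g * a)%g) ^+ 2 <= Q / 16.
  apply: le_trans offA2.
  rewrite [leRHS](reindex_inj (mulgI g)) /=.
  rewrite [leRHS](bigID (mem A)) /= -[leLHS]addr0 lerD ?sumr_ge0 // => [|i _].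
    rewrite le_eqVlt; apply/orP; left; apply/eqP; apply: eq_bigl => a; rewrite andbC.
    by case: (boolP (a \in A)) => //= aA; apply/esym/negP => gaA; apply: noA; exists a.
  exact: sqr_ge0.
(* Here 9/16 is the square of 3/4, the lower bound for [|f|] on products of four elements of [A].
   Summed over [A], which has at least [15 / 16 * Q] elements, it exceeds [Q / 16]. *)
have : \sum_(a in A) (9 / 16 : R) <= \sum_(a in A) normc (f (g * a)%g) ^+ 2.
  apply: ler_sum => a; rewrite inE => aA.
  have e1 := sph_almost_mult sf x y; have e2 := sph_almost_mult sf z a.
  have := sph_almost_mult sf (x * y)%g (z * a)%g; rewrite mulgA -/g.
  have /andP[] := f01 (g * a)%g; nra.
rewrite sumr_const -mulr_natr.
have := cardA; have := Q0; lra.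
Qed.

Let K : {set H} := (A * A)%g.

(** By [AAA], three factors from [A] can be replaced by two, so a product of four reduces to a
    product of two. *)
Let group_setK : group_set K.
Proof.
apply/group_setP; split; first by apply/mulsgP; exists 1%g 1%g; rewrite ?mulg1.
move=> _ y /mulsgP[a b aA bA ->] /mulsgP[c e cA eA ->].
rewrite mulgA; have /mulsgP[a' b' a'A b'A ->] := AAA aA bA cA.
exact: AAA.
Qed.

Let KG : {group H} := group group_setK.

Let fK x : x \in K -> 15 / 16 <= normc (f x).
Proof.
move=> /mulsgP[a b + + ->]; rewrite !inE => aA bA.
have := sph_almost_mult sf a b; lra.
Qed.

Let KJ x t : (x ^ t \in K)%g = (x \in K).
Proof.
have KJ1 y s : y \in K -> (y ^ s)%g \in K.
  by move=> /mulsgP[a b aA bA ->]; rewrite conjMg; apply: mem_mulg; rewrite AJ.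
apply/idP/idP; last exact: KJ1.
by move=> /(KJ1 _ t^-1%g); rewrite conjgK.
Qed.

Let L : R := \sum_(x in K) normc (f x) ^+ 2.

(** This is [sph_classM] for the class function equal to [conj f] on [K] and to 0 elsewhere. It
    makes [f / L] an idempotent for convolution on [K]. *)
Let convK x : \sum_(y in K) f (x * y)%g * f y^-1%g = f x * L%:C%C.
Proof.
have := sph_classM sf (a := fun y => (y \in K)%:R * f y^-1%g) x _.
have E (P : H -> C) : \sum_y P y * ((y \in K)%:R * f y^-1%g) =
    \sum_(y in K) P y * f y^-1%g.
  rewrite [RHS]big_mkcond; apply: eq_bigr => y _.
  by case: (y \in K); rewrite ?mul1r // mul0r mulr0.
rewrite !E => ->; last by move=> y t; rewrite KJ -conjVg (sph_class sf).
congr (_ * _); rewrite rmorph_sum; apply: eq_bigr => y _.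
by rewrite (sphV sf) mul_conjc.
Qed.

Let L_bounds : L <= #|K|%:R < 2 * L.
Proof.
have K0 : 0 < #|K|%:R :> R by rewrite ltr0n (cardG_gt0 KG).
(* The square of 15/16, which exceeds 1/2. *)
have : \sum_(x in K) (225 / 256 : R) <= L.
  by apply: ler_sum => x /fK; nra.
rewrite sumr_const -mulr_natr => le1; apply/andP; split; last by lra.
rewrite -sumr_const; apply: ler_sum => x _; have /andP[] := f01 x; nra.
Qed.

Let L0 : 0 < L.
Proof. by have /andP[] := L_bounds; lra. Qed.

(* [P] is idempotent, so its trace [#|K| / L] is an integer; it lies in [1, 2). *)
Let LK : L = #|K|%:R.
Proof.
pose e (i : 'I_#|K|) : H := enum_val i.
have eK i : e i \in K by exact: enum_valP.
pose P : 'M[C]_#|K| := \matrix_(i, j) (L%:C%C^-1 * f ((e i)^-1 * e j)%g).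
have Ln0 : L%:C%C != 0 :> C by rewrite (fmorph_eq0 (real_complex R)) gt_eqF.
have KV y : (y^-1%g \in K) = (y \in K) by exact: (groupV KG).
have KM y z : y \in K -> (y * z \in K)%g = (z \in K) by exact: (@groupMl _ KG).
have PP : P *m P = P.
  apply/matrixP => i j; rewrite !mxE.
  under eq_bigr do rewrite !mxE.
  rewrite -(big_enum_val (fun k => L%:C%C^-1 * f ((e i)^-1 * k)%g *
    (L%:C%C^-1 * f (k^-1 * e j)%g))) /=.
  rewrite (reindex_inj (mulgI (e j))) /=.
  under eq_bigl do rewrite KM //.
  transitivity (L%:C%C^-1 * (L%:C%C^-1 *
      \sum_(k in K) f ((e i)^-1 * e j * k)%g * f k^-1%g)).
    rewrite !mulr_sumr; apply: eq_bigr => k _.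
    by rewrite invMg mulgKV mulgA mulrACA -!mulrA.
  by rewrite convK [f _ * _]mulrC mulKf.
have := mxtrace_idem PP; rewrite /mxtrace.
under eq_bigr do rewrite mxE mulVg (sph1 sf) mulr1.
rewrite sumr_const card_ord -[LHS]mulr_natr => /(canRL (mulVKf Ln0)).
rewrite -(rmorph_nat (real_complex R)) -(rmorph_nat (real_complex R) (\rank P)).
rewrite -rmorphM => /(fmorph_inj (real_complex R)).
have /andP[] := L_bounds.
case: (\rank P) => [|[|n]].
- by rewrite mulr0 => + _ E; rewrite E; have := L0; lra.
- by rewrite mulr1.
- move=> _ + E; rewrite E mulrC ltr_pM2r ?L0 //.
  by rewrite ltr_nat.
Qed.

(** [L] is a sum of [#|K|] terms that are at most 1, and [LK] says that it equals [#|K|]. *)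
Let f1 x : x \in K -> normc (f x) = 1.
Proof.
move=> xK; apply/eqP; rewrite eq_le; have /andP[_ ->] := f01 x; rewrite leNgt.
apply/negP => lt1; have := LK; apply/eqP; rewrite lt_eqF //.
rewrite -sumr_const /L (bigD1 x) //= [ltRHS](bigD1 x) //= ltr_leD //.
  by have /andP[] := f01 x; nra.
by apply: ler_sum => y _; have /andP[] := f01 y; nra.
Qed.

Let W x : C := f x * ((x \in K)%:R / #|K|%:R - Q^-1)%:C%C.

Let AK : A \subset K.
Proof.
by apply/fintype.subsetP => x xA; apply/mulsgP; exists x 1%g; rewrite ?mulg1.
Qed.

Let K0 : 0 < #|K|%:R :> R. Proof. by rewrite -LK. Qed.

Let KQ : #|K|%:R <= Q.
Proof.
rewrite -LK /Q /sph_sq [leRHS](bigID (mem K)) /= lerDl.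
by apply: sumr_ge0 => x _; exact: sqr_ge0.
Qed.

(** On [K] the moduli sum to [1 - #|K| / Q], at most 1/16 because [K] contains [A]; off [K] they sum
    to at most 1/16 by [offA]. *)
Let W_small : \sum_x normc (W x) <= 1 / 8.
Proof.
have -> : \sum_x normc (W x) =
    (1 - #|K|%:R / Q) + Q^-1 * \sum_(x | x \notin K) normc (f x).
  rewrite (bigID (mem K)) /=; congr (_ + _).
    rewrite (eq_bigr (fun=> #|K|%:R^-1 - Q^-1)) => [|x xK].
      by rewrite sumr_const -[LHS]mulr_natl mulrBr mulfV // gt_eqF.
    rewrite normcM f1 // mul1r xK div1r normc_real ger0_norm //.
    by rewrite subr_ge0 lef_pV2.
  rewrite mulr_sumr; apply: eq_bigr => x /negPf xK.
  rewrite normcM xK mul0r sub0r normc_real normrN mulrC.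
  by rewrite ger0_norm // invr_ge0 ltW.
have : \sum_(x | x \notin K) normc (f x) <= Q / 16.
  apply: le_trans offA; rewrite [leRHS](bigID (mem K)) /= -[leLHS]add0r lerD //.
    by apply: sumr_ge0 => x _; apply: normc_ge0.
  rewrite le_eqVlt; apply/orP; left; apply/eqP; apply: eq_bigl => x.
  by case: (boolP (x \in K)) => [|xK]; rewrite ?andbF // andbT;
    apply/esym/negP => /(fintype.subsetP AK); apply/negP.
rewrite -(ler_pM2l (x := Q^-1)) ?invr_gt0 // [X in _ <= X]mulKf ?gt_eqF //.
have : 15 / 16 <= #|K|%:R / Q.
  rewrite ler_pdivlMr //; apply: le_trans cardA _.
  by rewrite ler_nat subset_leq_card.
move: (#|K|%:R / Q) (Q^-1 * _) => a b. lra.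
Qed.

(* Up to conjugation, [W] is the difference of the idempotents attached to [K]
   and to [f]; being an idempotent of norm less than [1], it vanishes. *)
Let W_idem x : \sum_y W (x * y)%g * W y^-1%g = W x.
Proof.
have KV y : (y^-1%g \in K) = (y \in K) by exact: (groupV KG).
have WJ y t : W (y ^ t)%g = W y by rewrite /W KJ (sph_class sf).
have Kn0 : #|K|%:R != 0 :> R by rewrite gt_eqF.
(* Both idempotents pair to 1 with [f], so their difference pairs to 0; by [sph_classM] the
   convolution of [f] with [W] then vanishes. *)
have fW0 : \sum_y f y * W y^-1%g = 0.
  transitivity ((\sum_y normc (f y) ^+ 2 * ((y \in K)%:R / #|K|%:R - Q^-1))%:C%C : C).
    rewrite rmorph_sum; apply: eq_bigr => y _.
    by rewrite /W KV (sphV sf) mulrA mul_conjc -rmorphM.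
  under eq_bigr do rewrite mulrBr mulrA.
  rewrite sumrB -!mulr_suml -/(sph_sq f) -/Q mulfV ?gt_eqF //.
  rewrite (_ : \sum_i _ = #|K|%:R) ?mulfV ?subrr //.
  rewrite -LK /L [RHS]big_mkcond; apply: eq_bigr => y _.
  by case: (y \in K); rewrite ?mulr1 ?mulr0.
transitivity (\sum_y (f (x * y)%g * ((x * y \in K)%g%:R / #|K|%:R)%:C%C) * W y^-1%g
   - Q^-1%:C%C * \sum_y f (x * y)%g * W y^-1%g).
  rewrite mulr_sumr -sumrB; apply: eq_bigr => y _.
  by rewrite {1}/W rmorphB /=; ring.
rewrite (sph_classM sf (a := fun y => W y^-1%g)); last first.
  by move=> y t; rewrite -conjVg WJ.
rewrite fW0 !mulr0 subr0 (reindex_inj (mulgI x^-1%g)) /=.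
have KM y z : y \in K -> (y * z \in K)%g = (z \in K) by exact: (@groupMl _ KG).
transitivity ((#|K|%:R^-1%:C%C * ((x \in K)%:R / #|K|%:R - Q^-1)%:C%C) *
   (\sum_(y in K) f (x * y)%g * f y^-1%g)).
  rewrite mulr_sumr (reindex_inj invg_inj) [RHS]big_mkcond /=.
  apply: eq_bigr => y _; rewrite mulKVg KV; case: ifP => yK; last first.
    by rewrite !mul0r mulr0 mul0r.
  rewrite /W invMg !invgK KM // (sphC sf y x) div1r; ring.
have KK : #|K|%:R^-1%:C%C * #|K|%:R%:C%C = 1 :> C by rewrite -rmorphM mulVf.
by rewrite convK LK [f x * #|K|%:R%:C%C]mulrC mulrACA KK mul1r mulrC.
Qed.

Let W0 x : W x = 0.
Proof.
pose m := [arg max_(i > 1%g) normc (W i)]%O.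
have [y _ ymax] : extremum_spec >=%O xpredT (fun i => normc (W i)) m by apply: arg_maxP.
suff : normc (W y) <= 0.
  move=> Wy; apply/eqP; rewrite -normc_eq0 eq_le normc_ge0 andbT.
  exact: le_trans (ymax x isT) Wy.
have : normc (W y) <= \sum_z normc (W y) * normc (W z^-1%g).
  rewrite -{1}W_idem (le_trans (ler_normc_sum _ _ _)) //.
  apply: ler_sum => z _; rewrite normcM ler_wpM2r ?normc_ge0 //.
  exact: ymax.
rewrite -mulr_sumr (_ : \sum_i _ = \sum_z normc (W z)); last first.
  by rewrite [RHS](reindex_inj invg_inj).
have := W_small; have := normc_ge0 (W y); move: (normc _) (\sum_z _) => a b.
nra.
Qed.

(** Since [W] vanishes, its value at 1 gives [#|K| = Q] and its values off [K] give [f = 0] there.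
    So [|f|] is the indicator function of a subgroup of order [Q]. *)
Lemma sph_gap : sph_norm = 1.
Proof.
have KQ1 : #|K|%:R = Q.
  have := W0 1%g; rewrite /W (sph1 sf) mul1r (fintype.subsetP AK _ A1) div1r.
  move/eqP; rewrite (fmorph_eq0 (real_complex R)).
  by rewrite subr_eq0 => /eqP /invr_inj.
rewrite /sph_norm -/Q (bigID (mem K)) /= [X in _ + X]big1 ?addr0 => [|x /negPf xK].
  by rewrite (eq_bigr (fun=> 1)) // sumr_const KQ1 mulVf // gt_eqF.
have := W0 x; rewrite /W xK mul0r sub0r => /eqP.
rewrite mulf_eq0 (fmorph_eq0 (real_complex R)) oppr_eq0 invr_eq0 (gt_eqF Q0) orbF.
by move=> /eqP->; rewrite normc0.
Qed.

End Gap.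

(** * Schur's lemma and orthogonality: irreducible characters are spherical *)

Section Schur.
Variables (F : closedFieldType) (gT : finGroupType) (G : {group gT}) (n : nat).
Variable rG : mx_representation F G n.
Hypothesis irrG : mx_irreducible rG.

Lemma mx_irr_gt0 : (0 < n)%N.
Proof. by have /mx_irrP[] := irrG. Qed.

(** For an eigenvalue [a] of [A], the matrix [A - a] commutes with [rG] and is singular, so
    irreducibility makes it zero. *)
Lemma closed_centgmx_scalar (A : 'M[F]_n) : centgmx rG A -> exists a, A = a%:M.
Proof.
move=> /centgmxP cA.
have /closed_rootP[a ra] : size (char_poly A) != 1%N.
  by rewrite size_char_poly; have := mx_irr_gt0; case: (n).
exists a; apply/eqP; rewrite -subr_eq0; apply: contraT => nz.
have /(mx_Schur irrG) /(_ nz) : centgmx rG (A - a%:M).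
  apply/centgmxP => x Gx.
  by rewrite mulmxBl mulmxBr cA // scalar_mxC.
move: ra; rewrite -eigenvalue_root_char => /eigenvalueP[v vA nzv] uA.
case/eqP: nzv; rewrite -(mulmxK uA v) mulmxBr vA mul_mx_scalar subrr.
by rewrite mul0mx.
Qed.

End Schur.

Lemma mulmx_delta_entry (F : pzRingType) m n p q (A : 'M[F]_(m, n)) (B : 'M[F]_(p, q)) i k a b :
  (A *m delta_mx i k *m B) a b = A a i * B k b.
Proof.
rewrite -(mul_delta_mx (0 : 'I_1)) !mulmxA -colE -mulmxA -rowE.
by rewrite mxE big_ord1 !mxE.
Qed.

Lemma mxtrace_reprJ (F : fieldType) (H : finGroupType) n
  (rG : mx_representation F (setT_group H) n) x y :
  \tr (rG (x ^ y)%g) = \tr (rG x).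
Proof.
by rewrite conjgE repr_mxM ?inE // mxtrace_mulC -repr_mxM ?inE // mulgK.
Qed.

Section IrreducibleCharacter.
Variables (R : realType) (H : finGroupType) (n : nat).
Variable rG : mx_representation R[i] (setT_group H) n.
Hypothesis irrG : mx_irreducible rG.
Local Notation C := R[i].
Local Notation chi := (fun x => \tr (rG x)).

Let rM x y : rG (x * y)%g = rG x *m rG y.
Proof. by rewrite repr_mxM ?inE. Qed.

Let n0 : n%:R != 0 :> C.
Proof. by rewrite pnatr_eq0 -lt0n (mx_irr_gt0 irrG). Qed.

Lemma cent_scalar_trace (A : 'M[C]_n) : (forall x, A *m rG x = rG x *m A) ->
  A = (\tr A / n%:R)%:M.
Proof.
move=> cA; have [a ->] : exists a, A = a%:M.
  by apply: (closed_centgmx_scalar irrG); apply/centgmxP => x _; apply: cA.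
by rewrite mxtrace_scalar -[a *+ n]mulr_natr mulfK.
Qed.

(** The sum commutes with [rG], so it is scalar, and its trace determines the scalar. *)
Lemma irr_avg_conj (A : 'M[C]_n) :
  \sum_x rG x *m A *m rG x^-1%g = (#|H|%:R * \tr A / n%:R)%:M.
Proof.
rewrite [LHS]cent_scalar_trace => [|y].
  congr (_ / _)%:M; rewrite raddf_sum /= (eq_bigr (fun=> \tr A)) => [|x _].
    by rewrite sumr_const mulr_natl.
  by rewrite mxtrace_mulC mulmxA -rM mulVg repr_mx1 mul1mx.
rewrite mulmx_suml mulmx_sumr (reindex_inj (mulgI y)) /=.
apply: eq_bigr => x _.
by rewrite invMg !rM !mulmxA -[LHS]mulmxA -(rM y^-1%g) mulVg repr_mx1 mulmx1.
Qed.

(** Expanding both traces, the product of the [(i, i)] entry of [rG x] and the [(k, k)] entry of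
    [rG x^-1] is the [(i, k)] entry of [rG x *m delta_mx i k *m rG x^-1]. Summing over [x] brings
    this to [irr_avg_conj]. *)
Lemma irr_char_norm : \sum_x chi x * chi x^-1%g = #|H|%:R.
Proof.
transitivity (\sum_i \sum_k \sum_x (rG x *m delta_mx i k *m rG x^-1%g) i k).
  under [RHS]eq_bigr do rewrite exchange_big; rewrite exchange_big /=.
  apply: eq_bigr => x _; rewrite /mxtrace mulr_suml; apply: eq_bigr => i _.
  by rewrite mulr_sumr; apply: eq_bigr => k _; rewrite mulmx_delta_entry.
under eq_bigr do under eq_bigr do rewrite -summxE irr_avg_conj !mxE.
rewrite (eq_bigr (fun=> #|H|%:R / n%:R)) => [|i _].
  by rewrite sumr_const card_ord -[LHS]mulr_natr divfK.
have tr_delta k : \tr (delta_mx i k : 'M[C]_n) = (i == k)%:R.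
  rewrite /mxtrace (bigD1 i) //= mxE eqxx big1 ?addr0 // => j /negPf ji.
  by rewrite mxE ji.
rewrite (bigD1 i) //= eqxx mulr1n tr_delta eqxx mulr1 big1 ?addr0 // => k ki.
by rewrite eq_sym (negPf ki) mulr0n.
Qed.

(* Weyl's unitary trick: [M] is an invariant Hermitian form. *)
Lemma irr_charV x : chi x^-1%g = conjc (chi x).
Proof.
pose adj p q (A : 'M[C]_(p, q)) := (map_mx conjc A)^T.
have adjM p q r (A : 'M[C]_(p, q)) (B : 'M[C]_(q, r)) :
  adj _ _ (A *m B) = adj _ _ B *m adj _ _ A by rewrite /adj map_mxM trmx_mul.
pose M := \sum_y rG y *m adj _ _ (rG y).
have invM g : rG g *m M *m adj _ _ (rG g) = M.
  rewrite /M mulmx_sumr mulmx_suml [RHS](reindex_inj (mulgI g)) /=.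
  by apply: eq_bigr => y _; rewrite rM adjM !mulmxA.
have uM : M \in unitmx.
  rewrite -row_free_unit; apply: inj_row_free => v vM0.
  have : (\sum_y \sum_j normc ((v *m rG y) 0 j) ^+ 2)%:C%C = 0 :> C.
    transitivity ((v *m M *m adj _ _ v) 0 0); last by rewrite vM0 mul0mx mxE.
    rewrite /M mulmx_sumr mulmx_suml summxE rmorph_sum; apply: eq_bigr => y _.
    rewrite mulmxA -(mulmxA _ (adj _ _ (rG y))) -adjM mxE rmorph_sum.
    by apply: eq_bigr => j _; rewrite /= -mul_conjc !mxE.
  move/eqP; rewrite (fmorph_eq0 (real_complex R)) => /eqP /psumr_eq0P.
  move=> /(_ (fun y _ => sumr_ge0 _ (fun j _ => sqr_ge0 _)) 1%g isT) /psumr_eq0P.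
  move=> /(_ (fun j _ => sqr_ge0 _)) v0; apply/rowP => j.
  have := v0 j isT; rewrite repr_mx1 mulmx1 => /eqP.
  by rewrite expf_eq0 normc_eq0 mxE => /eqP.
rewrite (_ : conjc _ = \tr (adj _ _ (rG x))); last by rewrite mxtrace_tr trace_map_mx.
have -> : adj _ _ (rG x) = invmx M *m (rG x^-1%g *m M).
  by rewrite -[X in _ *m (_ *m X)](invM x) !mulmxA -(mulmxA (invmx M))
    -(rM x^-1%g) mulVg repr_mx1 mulmx1 mulVmx // mul1mx.
by rewrite mxtrace_mulC mulmxK.
Qed.

Lemma irr_char1 : chi 1%g = n%:R.
Proof. by rewrite /= repr_mx1 mxtrace1. Qed.

Lemma irr_char_spherical : spherical (fun x => chi x / n%:R).
Proof.
split=> [|x|x y].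
- by rewrite irr_char1 divff.
- by rewrite irr_charV rmorphM fmorphV rmorph_nat.
rewrite -mulr_suml.
have -> : \sum_t chi (x * y ^ t)%g = chi x * (#|H|%:R * chi y / n%:R).
  (* After inverting [t], this is [irr_avg_conj] for the matrix [rG y]. *)
  transitivity (\tr (rG x *m \sum_t rG t *m rG y *m rG t^-1%g)).
    rewrite mulmx_sumr raddf_sum (reindex_inj invg_inj) /=; apply: eq_bigr => t _.
    by rewrite conjgE !rM invgK !mulmxA.
  by rewrite irr_avg_conj mul_mx_scalar mxtraceZ mulrC.
by field.
Qed.

Lemma normc_nat k : normc (k%:R : C) = k%:R.
Proof. by rewrite -(rmorph_nat (real_complex R)) normc_real normr_nat. Qed.

Lemma irr_char_sq : n%:R ^+ 2 * sph_sq (fun x => chi x / n%:R) = #|H|%:R.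
Proof.
transitivity (\sum_x normc (chi x) ^+ 2).
  rewrite mulr_sumr; apply: eq_bigr => x _.
  have n0R : n%:R != 0 :> R by rewrite pnatr_eq0 -lt0n (mx_irr_gt0 irrG).
  by rewrite normcM normcV normc_nat; field.
apply: (fmorph_inj (real_complex R)).
rewrite rmorph_nat -irr_char_norm rmorph_sum.
by apply: eq_bigr => x _; rewrite irr_charV mul_conjc.
Qed.

(** With [|H| = n^2 * Q] from [irr_char_sq], both conditions say that [|chi|] sums to [n * Q]. *)
Lemma irr_char_sph_norm :
  chi 1%g * (\sum_x `|chi x|) = #|H|%:R <->
  sph_norm (fun x => chi x / n%:R) = 1.
Proof.
have n0R : n%:R != 0 :> R by rewrite pnatr_eq0 -lt0n (mx_irr_gt0 irrG).
have -> : chi 1%g * (\sum_x `|chi x|) = (n%:R * \sum_x normc (chi x))%:C%C.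
  by rewrite rmorphM rmorph_nat rmorph_sum irr_char1; congr (_ * _).
rewrite -(rmorph_nat (real_complex R)) -irr_char_sq /sph_norm.
have -> : \sum_x normc (chi x / n%:R) = n%:R^-1 * \sum_x normc (chi x).
  by rewrite mulr_sumr; apply: eq_bigr => x _; rewrite normcM normcV normc_nat mulrC.
have Q0 := lt0r_neq0 (sph_sq_gt0 irr_char_spherical).
move: (sph_sq _) (\sum_x _) Q0 => Q S Q0; split=> [/(fmorph_inj (real_complex R)) E | E].
  have -> : S = n%:R * Q by apply: (mulfI n0R); rewrite E; ring.
  by field; rewrite n0R Q0.
have -> : S = n%:R * Q * (Q^-1 * (n%:R^-1 * S)) by field; rewrite n0R Q0.
by rewrite E; congr (_%:C%C); ring.
Qed.

End IrreducibleCharacter.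

Lemma irreducible_character_spherical (R : realType) (H : finGroupType) (chi : H -> R[i]) :
  irreducible_character chi ->
  exists f : H -> R[i], [/\ spherical f, forall x, chi x = chi 1%g * f x &
    chi 1%g * (\sum_x `|chi x|) = #|H|%:R <-> sph_norm f = 1].
Proof.
move=> [n [rG [irrG chiE]]]; have -> : chi = fun x => \tr (rG x) by apply/funext.
exists (fun x => \tr (rG x) / n%:R); split.
- exact: irr_char_spherical.
- move=> x; rewrite (irr_char1 rG) mulrC divfK //.
  by rewrite pnatr_eq0 -lt0n (mx_irr_gt0 irrG).
- exact: irr_char_sph_norm.
Qed.

(** * Every spherical function comes from an irreducible character *)

Section SphericalIrreducible.
Variables (R : realType) (H : finGroupType) (f : H -> R[i]).
Hypothesis sf : spherical f.
Local Notation C := R[i].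
Local Notation G := (setT_group H).
Local Notation aG := (regular_repr C G).

Let e (x : H) : 'rV[C]_(gcard G) := delta_mx 0 (gring_index G x).

Let eM x y : e x *m aG y = e (x * y)%g.
Proof. by rewrite /e -rowE rowK gring_indexK ?inE. Qed.

(** An element of the regular module that is an eigenvector of all the class sums [Z y], see
    [vZ]. *)
Let v := \sum_x f x^-1%g *: e x.

Let v_neq0 : v != 0.
Proof.
apply/eqP => /rowP /(_ (gring_index G 1%g)) /eqP.
rewrite summxE (bigD1 1%g) //= big1 ?addr0 => [|x x1].
  by rewrite !mxE !eqxx invg1 (sph1 sf) mulr1 oner_eq0.
rewrite !mxE eqxx /= (inj_in_eq (can_in_inj (@gring_indexK _ G))) ?inE //.
by rewrite eq_sym (negPf x1) mulr0.
Qed.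

Let Z y := \sum_t aG (y ^ t)%g.

Let vZ y : v *m Z y = (#|H|%:R * f y) *: v.
Proof.
rewrite mulmx_sumr.
transitivity (\sum_t \sum_x f (x^-1 * y ^ t)%g *: e x).
  apply: eq_bigr => t _.
  rewrite mulmx_suml [RHS](reindex_inj (mulIg (y ^ t)%g)); apply: eq_bigr => x _ /=.
  by rewrite -scalemxAl eM invMg (sphC sf) mulKVg.
rewrite exchange_big scaler_sumr; apply: eq_bigr => x _ /=.
by rewrite -scaler_suml (sphM sf) scalerA; congr (_ *: _); ring.
Qed.

Let Z_cent y x : Z y *m aG x = aG x *m Z y.
Proof.
rewrite mulmx_suml mulmx_sumr [RHS](reindex_inj (mulIg x)) /=.
apply: eq_bigr => t _; rewrite -!repr_mxM ?inE //; congr (aG _).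
by rewrite conjgM -conjgC.
Qed.

(** The class sums are central, so they act on the whole cyclic module of [v] by the scalars
    [|H| * f y]. A simple submodule inherits these scalars, and taking traces recovers [f] from its
    character. *)
Lemma spherical_irreducible_character :
  exists2 chi : H -> C, irreducible_character chi & forall x, chi x = chi 1%g * f x.
Proof.
have modU := cyclic_mx_module aG v.
have nzU : cyclic_mx aG v != 0 by rewrite cyclic_mx_eq0 v_neq0.
have [V simV sVU] := dec_mxsimple_exists modU nzU.
have [modV nzV _] := simV.
pose rG := submod_repr modV.
have irrG : mx_irreducible rG by apply/submod_mx_irr.
have actZ m (W : 'M[C]_(m, gcard G)) y : (W <= V)%MS -> W *m Z y = (#|H|%:R * f y) *: W.
  move=> sWV; apply/row_matrixP => i; rewrite row_mul linearZ /=.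
  have /cyclic_mxP[A /envelop_mxP[a aE] ->] : (row i W <= cyclic_mx aG v)%MS.
    by rewrite (submx_trans (row_sub i W)) ?(submx_trans sWV).
  have cA : A *m Z y = Z y *m A.
    rewrite aE mulmx_suml mulmx_sumr; apply: eq_bigr => x _.
    by rewrite -scalemxAl -Z_cent scalemxAr.
  by rewrite -mulmxA cA mulmxA vZ scalemxAl.
have rZ y : \sum_t rG (y ^ t)%g = (#|H|%:R * f y)%:M.
  apply: (can_inj (@val_submodK _ _ V _)).
  rewrite linear_sum -scalemx1 linearZ /=.
  rewrite -(actZ _ _ y (val_submodP _)) mulmx_sumr; apply: eq_bigr => t _.
  by rewrite -[RHS](val_submodJ modV) ?mul1mx ?inE.
have cardH0 := @cardH_neq0 R H.
exists (fun x => \tr (rG x)); first by exists (\rank V), rG.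
move=> y; apply: (mulfI cardH0).
transitivity (\tr (\sum_t rG (y ^ t)%g)).
  rewrite raddf_sum mulr_natl -sumr_const; apply: eq_bigr => t _.
  exact/esym/(mxtrace_reprJ rG).
by rewrite rZ mxtrace_scalar repr_mx1 mxtrace1 -[LHS]mulr_natr; ring.
Qed.

End SphericalIrreducible.

Lemma spherical_sph_norm (R : realType) (H : finGroupType) (f : H -> R[i]) :
  spherical f ->
  (forall chi : H -> R[i], irreducible_character chi ->
     chi 1%g * (\sum_x `|chi x|) = #|H|%:R) ->
  sph_norm f = 1.
Proof.
move=> sf irrH; have [chi irr_chi chiE] := spherical_irreducible_character sf.
have [g [sg gE iffg]] := irreducible_character_spherical irr_chi.
have := iffg; rewrite (irrH _ irr_chi) => -[] /(_ erefl) <- _.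
have chi1 : chi 1%g != 0.
  have := irrH _ irr_chi; apply: contra_eq_neq => ->; rewrite mul0r eq_sym.
  exact: cardH_neq0.
by congr sph_norm; apply/funext => x; apply: (mulfI chi1); rewrite -chiE gE.
Qed.

Local Open Scope classical_set_scope.
Local Open Scope ring_scope.

(** * Summable functions and convolution *)

#[local] Existing Instance totally_filter.

Section Sums.
Variables (R : realType) (T : choiceType).
Local Notation C := R[i].
Implicit Types (f g : T -> C) (a : T -> R) (A B : {fset T}).

(** Convergence along finite subsets, with real [e] and the real modulus; [has_sum_sum] passes to
    the filter limit [sum], whose norm takes values in [R[i]]. *)
Definition has_sum f (l : C) := forall e : R, 0 < e ->
  exists A, forall B, (A `<=` B)%fset -> normc (\sum_(x <- B) f x - l) < e.

Lemma has_sum_sum f l : has_sum f l -> sum (f : T -> C^o) = l.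
Proof.
move=> fl; apply/cvg_lim; first exact: norm_hausdorff.
apply/cvgrPdist_lt => e e0.
have /fl[A HA] : 0 < complex.Re e by move: e0; rewrite ltcE => /andP[].
exists A => // B /= /HA.
have -> : \sum_(x <- B) f x = partial_sum (f : T -> C^o) B.
  by rewrite /partial_sum big_seq_fsetE.
rewrite normcBC normcE ltcE /= => ->; rewrite andbT.
by move: e0; rewrite ltcE => /andP[].
Qed.

Lemma has_sumD f g l m : has_sum f l -> has_sum g m ->
  has_sum (fun x => f x + g x) (l + m).
Proof.
move=> fl gm e e0; have e20 : 0 < e / 2 by rewrite divr_gt0.
have [A HA] := fl _ e20; have [B HB] := gm _ e20; exists (A `|` B)%fset => D.
rewrite fsubUset => /andP[/HA + /HB]; rewrite big_split /= => lt1 lt2.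
rewrite opprD addrACA (le_lt_trans (ler_normcD _ _)) //.
by rewrite [e]splitr ltrD.
Qed.

Lemma has_sumZ c f l : has_sum f l -> has_sum (fun x => c * f x) (c * l).
Proof.
move=> fl e e0; have c0 : 0 < normc c + 1 by rewrite ltr_wpDl ?normc_ge0.
have [A HA] := fl (e / (normc c + 1)) (divr_gt0 e0 c0); exists A => B /HA.
rewrite -mulr_sumr -mulrBr normcM ltr_pdivlMr //; apply: le_lt_trans.
by rewrite mulrC ler_wpM2l ?normc_ge0 // lerDl.
Qed.

Lemma has_sum_fset A f : (forall x, x \notin A -> f x = 0) ->
  has_sum f (\sum_(x <- A) f x).
Proof.
move=> fA e e0; exists A => B AB.
rewrite (_ : \sum_(x <- B) f x = \sum_(x <- A) f x) ?subrr ?normc0 //.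
by apply/esym/big_fset_incl => // x _ /fA.
Qed.

Lemma ler_sum_fsubset a A B : (forall x, 0 <= a x) -> (A `<=` B)%fset ->
  \sum_(x <- A) a x <= \sum_(x <- B) a x.
Proof.
move=> a0 AB; rewrite (big_fsetID _ (mem A) B) /=.
rewrite [X in _ <= X + _](_ : _ = \sum_(x <- A) a x) ?lerDl ?sumr_ge0 //.
apply: eq_fbigl => x; rewrite !inE /=.
by apply/andP/idP => [[]//|xS]; split=> //; exact: (fsubsetP AB).
Qed.

Lemma le_esum_fset a B : (forall x, 0 <= a x) ->
  ((\sum_(x <- B) a x)%:E <= \esum_(x in [set: T]) (a x)%:E)%E.
Proof.
move=> a0; rewrite -sumEFin; apply: esum_ge.
exists [set` B]; first by split => //; exact: finite_fset.
by rewrite fsbig_finite ?finite_fset // set_fsetK.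
Qed.

Lemma esum_le_fset a (M : R) : (forall x, 0 <= a x) ->
  (forall B, \sum_(x <- B) a x <= M) ->
  (\esum_(x in [set: T]) (a x)%:E <= M%:E)%E.
Proof.
move=> a0 aM; apply: ge_ereal_sup => _ [S [finS _] <-].
by rewrite fsbig_finite //= sumEFin lee_fin.
Qed.

Lemma esum_approx a (s : R) : (forall x, 0 <= a x) ->
  (\esum_(x in [set: T]) (a x)%:E = s%:E)%E ->
  forall e : R, 0 < e -> exists A, forall B, (A `<=` B)%fset ->
    s - e < \sum_(x <- B) a x <= s.
Proof.
move=> a0 as_ e e0; have : ((s - e)%:E < \esum_(x in [set: T]) (a x)%:E)%E.
  by rewrite as_ lte_fin ltrBlDr ltrDl.
rewrite /esum => /ereal_sup_gt [_ [S [finS _] <-]].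
rewrite fsbig_finite //= sumEFin lte_fin => lt_S.
exists (fset_set S) => B AB; apply/andP; split.
  by apply: lt_le_trans lt_S _; apply: ler_sum_fsubset.
by rewrite -lee_fin -as_; exact: le_esum_fset.
Qed.

Lemma has_sum_ge0 a (s : R) : (forall x, 0 <= a x) ->
  (\esum_(x in [set: T]) (a x)%:E = s%:E)%E ->
  has_sum (fun x => (a x)%:C%C) s%:C%C.
Proof.
move=> a0 as_ e e0; have [A HA] := esum_approx a0 as_ e0.
exists A => B /HA /andP[lt1 le2].
rewrite -(rmorph_sum (real_complex R)) -(rmorphB (real_complex R)).
by rewrite normc_real ler0_norm ?subr_le0 // opprB ltrBlDr -ltrBlDl.
Qed.

Definition abs_summable f : Prop :=
  (\esum_(x in [set: T]) (normc (f x))%:E < +oo)%E.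

Lemma le_abs_summable f a (c : R) : (forall x, 0 <= a x) -> 
  (forall x, a x <= c * normc (f x)) -> abs_summable f ->
  exists s : R, (\esum_(x in [set: T]) (a x)%:E = s%:E)%E.
Proof.
move=> a0 af fs; set E := esum _ _; have E0 : (0 <= E)%E.
  by apply: esum_ge0 => x _; rewrite lee_fin.
suff Eoo : (E < +oo)%E by exists (fine E); rewrite fineK // ge0_fin_numE.
have [s fs_] : exists s : R, \esum_(x in [set: T]) (normc (f x))%:E = s%:E.
  exists (fine (\esum_(x in [set: T]) (normc (f x))%:E)); rewrite fineK //.
  by rewrite ge0_fin_numE // esum_ge0 // => x _; rewrite lee_fin normc_ge0.
apply: (@le_lt_trans _ _ (`|c| * s)%:E); last exact: ltry.
apply: esum_le_fset => // B.
apply: (@le_trans _ _ (\sum_(x <- B) `|c| * normc (f x))).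
  apply: ler_sum => x _; apply: le_trans (af x) _.
  by rewrite ler_wpM2r ?normc_ge0 ?ler_norm.
rewrite -mulr_sumr ler_wpM2l // -lee_fin -fs_.
by apply: le_esum_fset => x; apply: normc_ge0.
Qed.

(** Write [h] as [|h| - (|h| - h)], a difference of nonnegative summable functions. *)
Lemma has_sum_real_dominated f (h : T -> R) : abs_summable f ->
  (forall x, `|h x| <= normc (f x)) -> exists l, has_sum (fun x => (h x)%:C%C) l.
Proof.
move=> fs hf.
have [||s1 H1] := @le_abs_summable f (fun x => `|h x|) 1 _ _ fs => [//|x|].
  by rewrite mul1r.
have d0 x : 0 <= `|h x| - h x by rewrite subr_ge0 ler_norm.
have [||s2 H2] := @le_abs_summable f (fun x => `|h x| - h x) 2 _ _ fs => [//|x|].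
  by have := hf x; have := ler_norm (- h x); rewrite normrN; lra.
have {}H1 := has_sum_ge0 (fun x => normr_ge0 _) H1.
have {}H2 := has_sumZ (-1) (has_sum_ge0 d0 H2).
exists (s1%:C%C + -1 * s2%:C%C); have := has_sumD H1 H2.
congr has_sum; apply/funext => x; rewrite mulN1r -rmorphB /=.
by congr (_%:C%C); rewrite opprB addrC subrK.
Qed.

Lemma abs_summable_has_sum f : abs_summable f -> exists l, has_sum f l.
Proof.
move=> fs.
have [l1 H1] := has_sum_real_dominated fs (fun x => Re_le_normc (f x)).
have [l2 H2] := has_sum_real_dominated fs (fun x => Im_le_normc (f x)).
exists (l1 + 'i%C * l2); have := has_sumD H1 (has_sumZ 'i%C H2).
by congr has_sum; apply/funext => x; rewrite -complexE.
Qed.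

Lemma has_sum_le f l (M : R) : has_sum f l ->
  (\esum_(x in [set: T]) (normc (f x))%:E <= M%:E)%E -> normc l <= M.
Proof.
move=> fl fM; apply/ler_addgt0Pr => e /fl [A /(_ A (fsubset_refl _))] lt_e.
rewrite -(subrK (\sum_(x <- A) f x) l) addrC (le_trans (ler_normcD _ _)) //.
rewrite lerD //; last by rewrite normcBC ltW.
rewrite (le_trans (ler_normc_sum _ _ _)) // -lee_fin; apply: le_trans fM.
by apply: le_esum_fset => x; apply: normc_ge0.
Qed.

End Sums.

Section FctE.
Variables (T : Type) (R : realType).
Implicit Types f g : T -> R[i].
Lemma fct_addE f g x : (f + g) x = f x + g x. Proof. by []. Qed.
Lemma fct_oppE f x : (- f) x = - f x. Proof. by []. Qed.
Lemma fct_mulE f g x : (f * g) x = f x * g x. Proof. by []. Qed.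
Lemma fct_scaleE (c : R[i]) f x : (c *: f) x = c * f x. Proof. by []. Qed.
Lemma fct_zeroE x : (0 : T -> R[i]) x = 0. Proof. by []. Qed.
Definition fE := (fct_addE, fct_oppE, fct_mulE, fct_scaleE, fct_zeroE).
End FctE.

(** * The convolution algebra of a discrete group and its centre *)

Section Ell1.
Variables (R : realType) (G : groupType).
Local Notation C := R[i].
Implicit Types (f g h u v : G -> C).

(** [fine] sends an infinite norm to 0, so an upper bound on [nrm f] is informative only together
    with [ell1 f]; many lemmas below therefore conclude both. *)
Definition nrm f : R := fine (ell1_norm f).
Definition csum f : C := sum (f : G -> C^o).

Lemma ell1_norm_ge0 f : (0 <= ell1_norm f)%E.
Proof. by apply: esum_ge0 => x _; rewrite lee_fin normc_ge0. Qed.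

Lemma ell1_normE f : ell1 f -> ell1_norm f = (nrm f)%:E.
Proof. by move=> ef; rewrite fineK // ge0_fin_numE ?ell1_norm_ge0. Qed.

Lemma nrm_ge0 f : 0 <= nrm f.
Proof. exact/fine_ge0/ell1_norm_ge0. Qed.

Lemma ell1_fset_le f (B : {fset G}) : ell1 f -> \sum_(x <- B) normc (f x) <= nrm f.
Proof.
move=> ef; rewrite -lee_fin -ell1_normE //.
by apply: le_esum_fset => x; apply: normc_ge0.
Qed.

Lemma ell1_fset_bound f (M : R) : (forall B : {fset G}, \sum_(x <- B) normc (f x) <= M) ->
  ell1 f /\ nrm f <= M.
Proof.
move=> fM; have le_fM : (ell1_norm f <= M%:E)%E.
  by apply: esum_le_fset => // x; apply: normc_ge0.
have ef : ell1 f by apply: le_lt_trans le_fM (ltry _).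
by rewrite -lee_fin -ell1_normE.
Qed.

Lemma ell1_le f g (c : R) : 0 <= c -> ell1 g ->
  (forall x, normc (f x) <= c * normc (g x)) -> ell1 f /\ nrm f <= c * nrm g.
Proof.
move=> c0 eg fg; apply: ell1_fset_bound => B.
apply: (@le_trans _ _ (\sum_(x <- B) c * normc (g x))); first by apply: ler_sum.
by rewrite -mulr_sumr ler_wpM2l // ell1_fset_le.
Qed.

Lemma ell1_addle f g : ell1 f -> ell1 g -> ell1 (f + g) /\ nrm (f + g) <= nrm f + nrm g.
Proof.
move=> ef eg; apply: ell1_fset_bound => B.
apply: (@le_trans _ _ (\sum_(x <- B) (normc (f x) + normc (g x)))).
  by apply: ler_sum => x _; apply: ler_normcD.
by rewrite big_split lerD // ell1_fset_le.
Qed.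

Lemma ell1D f g : ell1 f -> ell1 g -> ell1 (f + g).
Proof. by move=> ef eg; have [] := ell1_addle ef eg. Qed.

Lemma nrmD f g : ell1 f -> ell1 g -> nrm (f + g) <= nrm f + nrm g.
Proof. by move=> ef eg; have [] := ell1_addle ef eg. Qed.

Lemma ell1_scale (c : C) f : ell1 f -> ell1 (c *: f) /\ nrm (c *: f) <= normc c * nrm f.
Proof.
move=> ef; apply: ell1_le => // [|x]; first exact: normc_ge0.
by rewrite -normcM.
Qed.

Lemma ell1Z (c : C) f : ell1 f -> ell1 (c *: f).
Proof. by move=> ef; have [] := ell1_scale c ef. Qed.

Lemma nrmZ (c : C) f : ell1 f -> nrm (c *: f) <= normc c * nrm f.
Proof. by move=> ef; have [] := ell1_scale c ef. Qed.

Lemma ell1N f : ell1 f -> ell1 (- f).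
Proof. by move=> ef; rewrite -scaleN1r; apply: ell1Z. Qed.

Lemma ell1B f g : ell1 f -> ell1 g -> ell1 (f - g).
Proof. by move=> ef eg; apply: ell1D => //; apply: ell1N. Qed.

Lemma nrmN f : nrm (- f) = nrm f.
Proof.
by rewrite /nrm; congr fine; apply: eq_esum => x _; rewrite normcN.
Qed.

Lemma nrmB f g : ell1 f -> ell1 g -> nrm (f - g) <= nrm f + nrm g.
Proof.
by move=> ef eg; rewrite -(nrmN g); apply: nrmD => //; apply: ell1N.
Qed.

Lemma ell1_0 : ell1 (0 : G -> C).
Proof.
have [] // := @ell1_fset_bound (0 : G -> C) 0 => B.
by rewrite big1 // => x _; rewrite normc0.
Qed.

Lemma ell1_sum_le (I : Type) (s : seq I) (P : pred I) (F : I -> G -> C) :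
  (forall i, P i -> ell1 (F i)) ->
  ell1 (\sum_(i <- s | P i) F i) /\
  nrm (\sum_(i <- s | P i) F i) <= \sum_(i <- s | P i) nrm (F i).
Proof.
move=> eF; elim/big_rec2: _ => [|i a b Pi [eb le_ba]].
  split; first exact: ell1_0.
  by have [] // := @ell1_fset_bound (0 : G -> C) 0 => B; rewrite big1 // => x _; rewrite normc0.
have [eD le_D] := ell1_addle (eF i Pi) eb; split => //.
by apply: le_trans le_D _; rewrite lerD2l.
Qed.

Lemma ell1_sum (I : Type) (s : seq I) (P : pred I) (F : I -> G -> C) :
  (forall i, P i -> ell1 (F i)) -> ell1 (\sum_(i <- s | P i) F i).
Proof. by move=> /(ell1_sum_le s)[]. Qed.

Lemma ell1_norm_reindex f (h k : G -> G) : cancel h k -> cancel k h ->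
  ell1_norm (f \o h) = ell1_norm f.
Proof.
move=> hk kh; rewrite /ell1_norm.
rewrite [RHS](@reindex_esum R G G setT setT h) //; split => //.
- by move=> x y _ _ /(can_inj hk).
- by move=> y _; exists (k y).
Qed.

Lemma ell1_reindex f (h k : G -> G) : cancel h k -> cancel k h ->
  ell1 f -> ell1 (f \o h).
Proof. by move=> hk kh; rewrite /ell1 /= (ell1_norm_reindex _ hk kh). Qed.

Lemma nrm_reindex f (h k : G -> G) : cancel h k -> cancel k h ->
  nrm (f \o h) = nrm f.
Proof. by move=> hk kh; rewrite /nrm (ell1_norm_reindex _ hk kh). Qed.

Lemma csumP f : ell1 f -> has_sum f (csum f).
Proof.
move=> /(abs_summable_has_sum)[l fl]; rewrite /csum.
by rewrite (has_sum_sum fl).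
Qed.

Lemma csum_eq f l : has_sum f l -> csum f = l.
Proof. exact: has_sum_sum. Qed.

Lemma csumD f g : ell1 f -> ell1 g -> csum (f + g) = csum f + csum g.
Proof. by move=> /csumP ef /csumP eg; apply/csum_eq/has_sumD. Qed.

Lemma csumZ c f : ell1 f -> csum (c *: f) = c * csum f.
Proof. by move=> /csumP ef; apply/csum_eq/has_sumZ. Qed.

Lemma csum_fset (A : {fset G}) f : (forall x, x \notin A -> f x = 0) ->
  csum f = \sum_(x <- A) f x.
Proof. by move=> fA; apply/csum_eq/has_sum_fset. Qed.

Lemma csum0 : csum (0 : G -> C) = 0.
Proof. by rewrite (@csum_fset fset0) // big_seq_fset0. Qed.

Lemma csumN f : ell1 f -> csum (- f) = - csum f.
Proof. by move=> ef; rewrite -scaleN1r csumZ // mulN1r. Qed.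

Lemma csumB f g : ell1 f -> ell1 g -> csum (f - g) = csum f - csum g.
Proof. by move=> ef eg; rewrite csumD ?csumN //; apply: ell1N. Qed.

Lemma csum_sum (I : Type) (s : seq I) (P : pred I) (F : I -> G -> C) :
  (forall i, P i -> ell1 (F i)) ->
  csum (\sum_(i <- s | P i) F i) = \sum_(i <- s | P i) csum (F i).
Proof.
move=> eF; elim: s => [|i s IH]; first by rewrite !big_nil csum0.
rewrite !big_cons; case: ifP => // Pi.
by rewrite csumD ?IH //; [exact: eF | exact: ell1_sum].
Qed.

Lemma csum_le f : ell1 f -> normc (csum f) <= nrm f.
Proof.
move=> ef; apply: (has_sum_le (csumP ef)).
by rewrite -[leLHS]/(ell1_norm f) ell1_normE.
Qed.

Lemma csum_reindex f (h k : G -> G) : cancel h k -> cancel k h ->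
  ell1 f -> csum (f \o h) = csum f.
Proof.
move=> hk kh /csumP fl; apply: csum_eq => e /fl[A HA].
exists (k @` A)%fset => B AB.
rewrite (_ : \sum_(x <- B) _ = \sum_(y <- (h @` B)%fset) f y); last first.
  by rewrite big_imfset //= => x y _ _ /(can_inj hk).
apply: HA; apply/fsubsetP => x xA; apply/imfsetP; exists (k x) => //=.
by apply: (fsubsetP AB); apply/imfsetP; exists x.
Qed.

Lemma ell1_mulr u b (c : R) : 0 <= c -> ell1 u -> (forall x, normc (b x) <= c) ->
  ell1 (u * b) /\ nrm (u * b) <= c * nrm u.
Proof.
move=> c0 eu bc; apply: ell1_le => // x.
by rewrite normcM mulrC ler_wpM2r ?normc_ge0.
Qed.

Lemma normc_le_nrm f x : ell1 f -> normc (f x) <= nrm f.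
Proof.
by move=> ef; have := ell1_fset_le [fset x]%fset ef; rewrite big_seq_fset1.
Qed.

Local Open Scope group_scope.

Lemma lmulK (y : G) : cancel (fun x => y * x) (fun x => y^-1 * x).
Proof. exact: mulKg. Qed.

Lemma lmulVK (y : G) : cancel (fun x => y^-1 * x) (fun x => y * x).
Proof. exact: mulVKg. Qed.

Local Close Scope group_scope.

Lemma ell1_conv_term f g x : ell1 f -> ell1 g ->
  ell1 (fun y => f y * g (y^-1 * x)%g) /\
  nrm (fun y => f y * g (y^-1 * x)%g) <= nrm g * nrm f.
Proof.
move=> ef eg; apply: ell1_mulr; rewrite ?nrm_ge0 // => y.
exact: normc_le_nrm.
Qed.

Lemma convE f g x : convolution f g x = csum (fun y => f y * g (y^-1 * x)%g).
Proof. by []. Qed.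

(** For the partial sum over a finite [B], only a finite sum has to be exchanged with the sum over
    [y]. Each inner sum is then at most [|f y|] times the norm of a translate of [g]. *)
Lemma ell1_conv_le f g : ell1 f -> ell1 g ->
  ell1 (convolution f g) /\ nrm (convolution f g) <= nrm f * nrm g.
Proof.
move=> ef eg; apply: ell1_fset_bound => B.
pose F x y := normc (f y * g (y^-1 * x)%g).
apply: (@le_trans _ _ (\sum_(x <- B) nrm (fun y => f y * g (y^-1 * x)%g))).
  by apply: ler_sum => x _; apply: csum_le; have [] := ell1_conv_term x ef eg.
rewrite -lee_fin -sumEFin.
rewrite (eq_bigr (fun x => \esum_(y in [set: G]) (F x y)%:E)%E); last first.
  by move=> x _; rewrite -ell1_normE //; have [] := ell1_conv_term x ef eg.
rewrite -esum_sum; last by move=> x y _ _; rewrite lee_fin normc_ge0.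
under eq_esum => y _ do rewrite sumEFin.
apply: esum_le_fset => [y|A]; first by apply: sumr_ge0 => x _; apply: normc_ge0.
apply: (@le_trans _ _ (\sum_(y <- A) normc (f y) * nrm g)); last first.
  by rewrite -mulr_suml ler_wpM2r ?nrm_ge0 // ell1_fset_le.
apply: ler_sum => y _; rewrite /F; under eq_bigr do rewrite normcM.
rewrite -mulr_sumr ler_wpM2l ?normc_ge0 //.
rewrite -(nrm_reindex g (lmulVK y) (lmulK y)).
by apply: (@ell1_fset_le (g \o _)); apply: ell1_reindex eg; [exact: lmulVK|exact: lmulK].
Qed.

Lemma ell1_conv f g : ell1 f -> ell1 g -> ell1 (convolution f g).
Proof. by move=> ef eg; have [] := ell1_conv_le ef eg. Qed.

Lemma nrm_conv f g : ell1 f -> ell1 g -> nrm (convolution f g) <= nrm f * nrm g.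
Proof. by move=> ef eg; have [] := ell1_conv_le ef eg. Qed.

Lemma convDl f g h : ell1 f -> ell1 g -> ell1 h ->
  convolution (f + g) h = convolution f h + convolution g h.
Proof.
move=> ef eg eh; apply/funext => x; rewrite [RHS]fct_addE !convE -csumD.
- by congr csum; apply/funext => y; rewrite !fE mulrDl.
- by have [] := ell1_conv_term x ef eh.
- by have [] := ell1_conv_term x eg eh.
Qed.

Lemma convDr f g h : ell1 f -> ell1 g -> ell1 h ->
  convolution f (g + h) = convolution f g + convolution f h.
Proof.
move=> ef eg eh; apply/funext => x; rewrite [RHS]fct_addE !convE -csumD.
- by congr csum; apply/funext => y; rewrite !fE mulrDr.
- by have [] := ell1_conv_term x ef eg.
- by have [] := ell1_conv_term x ef eh.
Qed.

Lemma convZl c f g : ell1 f -> ell1 g ->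
  convolution (c *: f) g = c *: convolution f g.
Proof.
move=> ef eg; apply/funext => x; rewrite [RHS]fct_scaleE !convE -[RHS]csumZ.
- by congr csum; apply/funext => y; rewrite !fE /= mulrA.
- by have [] := ell1_conv_term x ef eg.
Qed.

Lemma convZr c f g : ell1 f -> ell1 g ->
  convolution f (c *: g) = c *: convolution f g.
Proof.
move=> ef eg; apply/funext => x; rewrite [RHS]fct_scaleE !convE -[RHS]csumZ.
- by congr csum; apply/funext => y; rewrite !fE /= mulrCA.
- by have [] := ell1_conv_term x ef eg.
Qed.

Lemma convBr f g h : ell1 f -> ell1 g -> ell1 h ->
  convolution f (g - h) = convolution f g - convolution f h.
Proof.
move=> ef eg eh; rewrite convDr //; last exact: ell1N.
by rewrite -(scaleN1r h) convZr // scaleN1r.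
Qed.

Lemma convBl f g h : ell1 f -> ell1 g -> ell1 h ->
  convolution (f - g) h = convolution f h - convolution g h.
Proof.
move=> ef eg eh; rewrite convDl //; last exact: ell1N.
by rewrite -(scaleN1r g) convZl // scaleN1r.
Qed.

Lemma conv_sumr (I : Type) (s : seq I) (P : pred I) f (F : I -> G -> C) :
  ell1 f -> (forall i, P i -> ell1 (F i)) ->
  convolution f (\sum_(i <- s | P i) F i) = \sum_(i <- s | P i) convolution f (F i).
Proof.
move=> ef eF; elim: s => [|i s IH].
  rewrite !big_nil; apply/funext => x; rewrite convE -[RHS]csum0.
  by congr csum; apply/funext => y; rewrite mulr0.
rewrite !big_cons; case: ifP => // Pi.
by rewrite convDr ?IH //; [exact: eF | exact: ell1_sum].
Qed.

Definition delta (x : G) : G -> C := fun y => (y == x)%:R.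

Lemma delta_bound x (B : {fset G}) : \sum_(y <- B) normc (delta x y) <= 1 :> R.
Proof.
case: (boolP (x \in B)) => xB; last first.
  rewrite big_seq big1 // => y yB; rewrite /delta.
  by case: eqP => [yx|_]; rewrite ?normc0 //; rewrite -yx yB in xB.
rewrite (big_fsetD1 x) //= big_seq big1 ?addr0 /delta ?eqxx ?normc1 // => y.
by rewrite !inE => /andP[/negPf-> _]; rewrite normc0.
Qed.

Lemma ell1_delta x : ell1 (delta x).
Proof. by have [] := ell1_fset_bound (delta_bound x). Qed.

Lemma nrm_delta x : nrm (delta x) <= 1.
Proof. by have [] := ell1_fset_bound (delta_bound x). Qed.

Lemma csum_mul_delta x u : csum (delta x * u) = u x.
Proof.
rewrite (@csum_fset [fset x]%fset) => [|y]; last first.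
  by rewrite inE fE /delta => /negPf->; rewrite mul0r.
by rewrite big_seq_fset1 fE /delta eqxx mul1r.
Qed.

Lemma conv_deltal x f : convolution (delta x) f = fun y => f (x^-1 * y)%g.
Proof.
apply/funext => y; rewrite convE.
exact: (csum_mul_delta x (fun z => f (z^-1 * y)%g)).
Qed.

Lemma conv_deltar x f : convolution f (delta x) = fun y => f (y * x^-1)%g.
Proof.
apply/funext => y; rewrite convE (@csum_fset [fset (y * x^-1)%g]%fset).
  by rewrite big_seq_fset1 /delta invMg invgK mulgVK eqxx mulr1.
move=> z; rewrite inE /delta => zN; case: eqP => [zx|_]; last by rewrite mulr0.
by case/eqP: zN; rewrite -zx invMg invgK mulKVg.
Qed.

Lemma conv1f f : convolution (delta 1%g) f = f.
Proof. by rewrite conv_deltal; apply/funext => y; rewrite invg1 mul1g. Qed.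

Lemma convf1 f : convolution f (delta 1%g) = f.
Proof. by rewrite conv_deltar; apply/funext => y; rewrite invg1 mulg1. Qed.

Definition classfun_on f := forall x y : G, f (x ^ y)%g = f x.

(** Replace [y] by [x * y^-1] in the sum; invariance under conjugation turns [f (x * y^-1)] into
    [f (y^-1 * x)]. *)
Lemma convC f g : classfun_on f -> ell1 f -> ell1 g ->
  convolution f g = convolution g f.
Proof.
move=> cf ef eg; apply/funext => x; rewrite !convE.
have hh : cancel (fun y => x * y^-1)%g (fun y => y^-1 * x)%g.
  by move=> y; rewrite invMg invgK mulgVK.
have kk : cancel (fun y => y^-1 * x)%g (fun y => x * y^-1)%g.
  by move=> y; rewrite invMg invgK mulKVg.
have [e1 _] := ell1_conv_term x ef eg.
rewrite -(csum_reindex hh kk e1); congr csum; apply/funext => y /=.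
rewrite invMg invgK mulgVK mulrC; congr (_ * _).
by rewrite -(cf _ y) conjgE mulgVK.
Qed.

(** Commuting with point masses already forces invariance under conjugation; the converse is
    [convC]. *)
Lemma Zell1P f : Zell1 f <-> ell1 f /\ classfun_on f.
Proof.
split=> [[ef cf]|[ef cf]]; split=> //; last by move=> g eg; apply: convC.
move=> x y; have /(congr1 (fun u => u (x * y)%g)) := cf _ (ell1_delta y).
by rewrite conv_deltal conv_deltar mulgK conjgE => <-.
Qed.

Lemma classfun_conv f g : classfun_on f -> classfun_on g -> ell1 f -> ell1 g ->
  classfun_on (convolution f g).
Proof.
move=> cf cg ef eg x z; rewrite !convE.
have [e1 _] := ell1_conv_term x ef eg.
have [e2 _] := ell1_conv_term (x ^ z)%g ef eg.
rewrite -(csum_reindex (conjgK z) (conjgKV z) e2); congr csum; apply/funext => y /=.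
by rewrite -conjVg -conjMg cf cg.
Qed.

Lemma Zell1_conv f g : Zell1 f -> Zell1 g -> Zell1 (convolution f g).
Proof.
move=> /Zell1P[ef cf] /Zell1P[eg cg]; apply/Zell1P; split.
  exact: ell1_conv.
exact: classfun_conv.
Qed.

Lemma Zell1D f g : Zell1 f -> Zell1 g -> Zell1 (f + g).
Proof.
move=> /Zell1P[ef cf] /Zell1P[eg cg]; apply/Zell1P; split; first exact: ell1D.
by move=> x y; rewrite !fE cf cg.
Qed.

Lemma Zell1Z c f : Zell1 f -> Zell1 (c *: f).
Proof.
move=> /Zell1P[ef cf]; apply/Zell1P; split; first exact: ell1Z.
by move=> x y; rewrite !fE cf.
Qed.

Lemma Zell1B f g : Zell1 f -> Zell1 g -> Zell1 (f - g).
Proof. by move=> zf zg; apply: Zell1D => //; rewrite -scaleN1r; apply: Zell1Z. Qed.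

Lemma Zell1_0 : Zell1 (0 : G -> C).
Proof. by apply/Zell1P; split; [exact: ell1_0|]. Qed.

Lemma Zell1_1 : Zell1 (delta 1%g).
Proof.
apply/Zell1P; split; first exact: ell1_delta.
by move=> x y; rewrite /delta -{1}(conj1g y) (inj_eq (conjg_inj y)).
Qed.

Lemma Zell1_ell1 f : Zell1 f -> ell1 f.
Proof. by case. Qed.

End Ell1.

(** * Neumann series in the centre *)

Section Neumann.
Variables (R : realType) (G : groupType).
Local Notation C := R[i].
Variable r : G -> C.
Hypotheses (zr : Zell1 r) (r1 : nrm r < 1).
Let d : G -> C := @delta R G 1%g.
Let er : ell1 r := Zell1_ell1 zr.
Let rho := nrm r.
Let rho0 : 0 <= rho := nrm_ge0 r.
Let p n := iter n (convolution r) d.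
Let s n := \sum_(k < n) p k.

Let Zp n : Zell1 (p n).
Proof. by elim: n => [|n IH] /=; [exact: Zell1_1 | exact: Zell1_conv]. Qed.

Let ep n : ell1 (p n) := Zell1_ell1 (Zp n).

Let nrm_p n : nrm (p n) <= rho ^+ n.
Proof.
elim: n => [|n IH]; first exact: nrm_delta.
by rewrite exprS (le_trans (nrm_conv er (ep n))) // ler_wpM2l.
Qed.

Let es n : ell1 (s n).
Proof. by apply: ell1_sum => k _; apply: ep. Qed.

Let conv_s n : convolution r (s n) = s n.+1 - d.
Proof.
by rewrite /s big_ord_recl /= addrC addKr conv_sumr.
Qed.

Let geo m n : \sum_(m <= k < n) rho ^+ k <= rho ^+ m / (1 - rho).
Proof.
have r10 : 0 < 1 - rho by rewrite subr_gt0.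
rewrite ler_pdivlMr //; case: (leqP m n) => [mn|/ltnW nm]; last first.
  by rewrite big_geq // mul0r exprn_ge0.
rewrite mulrBr mulr1 mulr_suml.
under [X in _ - X]eq_bigr do rewrite -exprSr.
rewrite -sumrB; under eq_bigr do rewrite -opprB.
by rewrite sumrN telescope_sumr // opprB gerBl exprn_ge0.
Qed.

Let sum_fset_iota (V : nmodType) n (F : nat -> V) :
  \sum_(k <- [fset k in iota 0 n]%fset) F k = \sum_(k < n) F k.
Proof.
rewrite -(big_mkord xpredT F) /index_iota subn0; apply: perm_big.
apply: uniq_perm; rewrite ?fset_uniq ?iota_uniq // => k.
by rewrite !inE.
Qed.

Let mem_fset_iota n k : (k \in [fset k in iota 0 n]%fset) = (k < n)%N.
Proof. by rewrite !inE mem_iota. Qed.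

Let p_summable x : abs_summable (fun k => p k x).
Proof.
have le_M : (\esum_(k in [set: nat]) (normc (p k x))%:E <= (1 / (1 - rho))%:E)%E.
  apply: esum_le_fset => [k|B]; first exact: normc_ge0.
  apply: (@le_trans _ _ (\sum_(k <- B) rho ^+ k)).
    by apply: ler_sum => k _; apply: le_trans (normc_le_nrm x (ep k)) (nrm_p k).
  have [N BN] : exists N, (B `<=` [fset k in iota 0 N])%fset.
    exists (\max_(k <- B) k).+1; apply/fsubsetP => k kB.
    by rewrite mem_fset_iota ltnS; exact: (@leq_bigmax_seq _ _ xpredT id).
  apply: le_trans (ler_sum_fsubset _ BN) _; first by move=> k; apply: exprn_ge0.
  by have := geo 0 N; rewrite expr0 big_mkord sum_fset_iota.
exact: le_lt_trans le_M (ltry _).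
Qed.

(** The series is first summed pointwise; [v_tail] upgrades this to convergence in norm. *)
Let v x : C := sum (fun k => p k x : C^o).

Let v_lim x (e : R) : 0 < e -> exists N, forall m, (N <= m)%N -> normc (s m x - v x) < e.
Proof.
move=> e0; have [l pl] := abs_summable_has_sum (@p_summable x).
have -> : v x = l by apply: has_sum_sum.
have [A HA] := pl e e0; exists (\max_(k <- A) k).+1 => m lt_m.
have /HA : (A `<=` [fset k in iota 0 m])%fset.
  apply/fsubsetP => k kA; rewrite mem_fset_iota.
  by apply: leq_ltn_trans lt_m; exact: (@leq_bigmax_seq _ _ xpredT id).
by rewrite sum_fset_iota /s fct_sumE.
Qed.

Let v_class : classfun_on v.
Proof.
move=> x y; rewrite /v (_ : (fun k => p k (x ^ y)%g) = p^~ x) //.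
by apply/funext => k; have /Zell1P[_ ->] := Zp k.
Qed.

(** On a finite set [B] pointwise convergence is uniform, so there [v] may be replaced by a late
    partial sum [s m], and [s m - s n] is bounded by the geometric tail. *)
Let v_tail n : ell1 (v - s n) /\ nrm (v - s n) <= rho ^+ n / (1 - rho).
Proof.
apply: ell1_fset_bound => B; apply/ler_addgt0Pr => e e0.
(* The error [e] is shared among the points of [B]; adding 1 keeps the denominator positive for
   empty [B]. *)
pose e' := e / (#|` B|%:R + 1).
have B1 : 0 < #|` B|%:R + 1 :> R by rewrite ltr_wpDl.
have e'0 : 0 < e' by rewrite divr_gt0.
have [m [nm Hm]] : exists m, (n <= m)%N /\ forall x, x \in B -> normc (s m x - v x) < e'.
  pose N x := sval (cid (v_lim x e'0)).
  have HN x m : (N x <= m)%N -> normc (s m x - v x) < e' by exact: (svalP (cid (v_lim x e'0))).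
  exists (n + \max_(x <- B) N x)%N; split; first exact: leq_addr.
  by move=> x xB; apply: HN; rewrite (leq_trans _ (leq_addl _ _)) //;
    exact: (@leq_bigmax_seq _ _ xpredT N).
apply: (@le_trans _ _ (\sum_(x <- B) e' + \sum_(x <- B) normc ((s m - s n) x))).
  rewrite -big_split /= big_seq [leRHS]big_seq; apply: ler_sum => x xB.
  rewrite -(subrKA (s m)) fct_addE (le_trans (ler_normcD _ _)) // lerD2r.
  by rewrite fE normcBC ltW // Hm.
rewrite addrC lerD //; last first.
  rewrite big_const_seq count_predT iter_addr addr0 -mulr_natr /e' mulrAC.
  by rewrite ler_pdivrMr // ler_pM2l // lerDl.
apply: le_trans (ell1_fset_le _ (ell1B (es m) (es n))) _.
rewrite /s -!(big_mkord xpredT) (big_cat_nat (leq0n n) nm) //= addrAC subrr add0r.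
apply: le_trans (geo n m).
have [_ le1] := ell1_sum_le (index_iota n m) (fun k (_ : xpredT k) => ep k).
by apply: le_trans le1 _; apply: ler_sum => k _; apply: nrm_p.
Qed.

Lemma neumann_series : exists2 v0 : G -> C, Zell1 v0 & v0 - convolution r v0 = d.
Proof.
have r10 : 0 < 1 - rho by rewrite subr_gt0.
have ev : ell1 v.
  by rewrite -(subrK (s 0) v); apply: ell1D (es 0); have [] := v_tail 0.
exists v; first by apply/Zell1P; split.
apply/eqP; rewrite -subr_eq0; apply/eqP; set w := (X in X = _).
have ew : ell1 w.
  by apply: ell1B; [apply: ell1B => //; apply: ell1_conv | apply: ell1_delta].
(* By [conv_s], the defect [w] equals [(v - s n.+1) - r * (v - s n)] for every [n], and both tails
   are of order [rho ^+ n]. Hence [w] has norm 0. *)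
have w_le n : nrm w <= 2 / (1 - rho) * rho ^+ n.
  have -> : w = (v - s n.+1) - convolution r (v - s n).
    rewrite convBr // conv_s /w.
    apply/funext => x; rewrite !fE; ring.
  have [e1 le1] := v_tail n.+1; have [e2 le2] := v_tail n.
  apply: le_trans (nrmB e1 (ell1_conv er e2)) _.
  have -> : 2 / (1 - rho) * rho ^+ n = rho ^+ n / (1 - rho) + 1 * (rho ^+ n / (1 - rho)).
    by ring.
  rewrite lerD //.
    apply: le_trans le1 _; rewrite ler_pM2r ?invr_gt0 // exprS.
    by rewrite ler_piMl ?exprn_ge0 // ltW.
  apply: le_trans (nrm_conv er e2) _; rewrite ler_pM ?nrm_ge0 //; exact: ltW.
suff w0 : nrm w <= 0.
  apply/funext => x; apply/eqP; rewrite -normc_eq0 eq_le normc_ge0 andbT.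
  exact: le_trans (normc_le_nrm x ew) w0.
have : (fun n => 2 / (1 - rho) * rho ^+ n) @ \oo --> (0 : R).
  rewrite -[X in _ --> X](mulr0 (2 / (1 - rho))); apply: cvgMr.
  by apply: cvg_expr; rewrite ger0_norm.
move=> H; apply: (ler_cvg_to (cvg_cst (nrm w)) H).
by apply: nearW => n; exact: w_le.
Qed.

End Neumann.

(** * Restricted direct products *)

Definition coord (I : Type) (G : I -> finGroupType) (x : restricted_prod G) :
  forall i, G i := restricted_prod_val x.
Coercion coord : restricted_prod >-> Funclass.

Section RestrictedProduct.
Variables (I : Type) (G : I -> finGroupType).
Local Notation Gp := (restricted_prod G).
Local Notation J := {classic I}.
Implicit Types (x y z : Gp) (i j : I).

Lemma rp_ext x y : (forall i, x i = y i) -> x = y.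
Proof. by move=> xy; apply/val_inj/functional_extensionality_dep. Qed.

Lemma rpM x y i : (x * y)%g i = (x i * y i)%g.
Proof. by []. Qed.

Lemma rpV x i : (x^-1)%g i = ((x i)^-1)%g.
Proof. by []. Qed.

Lemma rp1 i : (1%g : Gp) i = 1%g.
Proof. by []. Qed.

Lemma rpJ x y i : (x ^ y)%g i = (x i ^ y i)%g.
Proof. by rewrite !conjgE !rpM rpV. Qed.

Definition supp x : set J := [set i | x i <> 1%g].

Lemma finite_supp x : finite_set (supp x).
Proof. by case: x => x xP; apply/asboolP. Qed.

Definition upd_fun x j (s : G j) : direct_prod G := @dfwith J G x j s.

Lemma upd_subproof x j (s : G j) : upd_fun x s \in almost_trivial (G := G).
Proof.
apply/asboolP; apply: (@sub_finite_set _ _ (supp x `|` [set (j : J)])).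
  move=> i /= xi1; have [->|ij] := eqVneq (i : J) (j : J); [by right|left].
  by move: xi1; rewrite /upd_fun dfwithout // eq_sym.
by rewrite finite_setU; split; [exact: finite_supp | exact: finite_set1].
Qed.

Definition upd x j (s : G j) : Gp := RestrictedProd (upd_subproof x s).

Lemma upd_in x j (s : G j) : upd x s j = s.
Proof. exact: dfwithin. Qed.

Lemma upd_out x j (s : G j) i : i <> j -> upd x s i = x i.
Proof. by move=> ij; apply: dfwithout; apply/eqP => ji; apply: ij. Qed.

Lemma upd_ext x y j : (y j = x j) -> (forall i, i <> j -> x i = y i) -> x = y.
Proof.
move=> e1 e2; apply: rp_ext => i; have [->|ij] := pselect (i = j); first by [].
exact: e2.
Qed.

Lemma upd_id x j : upd x (x j) = x.
Proof. by apply: (@upd_ext _ _ j) => [|i ij]; rewrite ?upd_in ?upd_out. Qed.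

Lemma upd_upd x j (s t : G j) : upd (upd x s) t = upd x t.
Proof. by apply: (@upd_ext _ _ j) => [|i ij]; rewrite ?upd_in ?upd_out. Qed.

Definition emb j (s : G j) : Gp := upd 1%g s.

Lemma mul_emb x j (s : G j) : (x * emb s)%g = upd x (x j * s)%g.
Proof.
apply: (@upd_ext _ _ j) => [|i ij]; rewrite rpM ?upd_in ?upd_out //.
by rewrite rp1 mulg1.
Qed.

Lemma embV j (s : G j) : (emb s)^-1%g = emb s^-1%g.
Proof.
apply: (@upd_ext _ _ j) => [|i ij]; rewrite rpV ?upd_in ?upd_out //.
by rewrite rp1 invg1.
Qed.

Lemma embM j (s t : G j) : emb (s * t)%g = (emb s * emb t)%g.
Proof.
apply: (@upd_ext _ _ j) => [|i ij]; rewrite rpM ?upd_in ?upd_out //.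
by rewrite rp1 mulg1.
Qed.

Lemma emb1 j : emb (1 : G j)%g = 1%g.
Proof. exact: upd_id. Qed.

Lemma conj_emb x j (r : G j) : (x ^ emb r)%g = upd x (x j ^ r)%g.
Proof.
apply: (@upd_ext _ _ j) => [|i ij]; rewrite rpJ ?upd_in ?upd_out //.
by rewrite rp1 conjg1.
Qed.

Lemma embJ j (s : G j) y : (emb s ^ y)%g = emb (s ^ y j)%g.
Proof.
apply: (@upd_ext _ _ j) => [|i ij]; rewrite rpJ ?upd_in ?upd_out //.
by rewrite rp1 conj1g.
Qed.

Lemma upd_conj x j (s : G j) y : (upd x s ^ y)%g = upd (x ^ y)%g (s ^ y j)%g.
Proof.
by apply: (@upd_ext _ _ j) => [|i ij]; rewrite rpJ ?upd_in ?upd_out // rpJ.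
Qed.

Definition dsupp x : {fset J} := fset_set (supp x).

Lemma in_dsupp x i : ((i : J) \in dsupp x) = (x i != 1%g).
Proof.
rewrite /dsupp in_fset_set; last exact: finite_supp.
by apply/idP/idP => [/set_mem /eqP //|/eqP xi]; apply: mem_set.
Qed.

Section ProductFunction.
Variable R : realType.
Local Notation C := R[i].
Implicit Types c : forall i, G i -> C.

(** The product runs over the coordinates of [x] that are not 1; when all [c i 1 = 1], any larger
    finite set of indices gives the same value ([prodfunE]). *)
Definition prodfun c x : C := \prod_(i <- dsupp x) c i (x i).

Lemma prodfunE c x (S : {fset J}) : (forall i, c i 1%g = 1) ->
  (dsupp x `<=` S)%fset -> prodfun c x = \prod_(i <- S) c i (x i).
Proof.
move=> c1 xS; apply: big_fset_incl => // i _; rewrite in_dsupp negbK => /eqP->.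
exact: c1.
Qed.

Lemma prodfun_split c x j : (forall i, c i 1%g = 1) ->
  prodfun c x = c j (x j) * prodfun c (upd x (1 : G j)%g).
Proof.
move=> c1; set y := upd _ _; pose S := ((j : J) |` dsupp x)%fset.
rewrite (@prodfunE c x S) ?fsubsetU1 //.
rewrite (@prodfunE c y (S `\ (j : J))%fset) //; last first.
  apply/fsubsetP => i; rewrite !inE !in_dsupp /y.
  by have [->|/eqP ij] := eqVneq (i : J) (j : J); rewrite ?upd_in ?eqxx ?upd_out.
rewrite (big_fsetD1 (j : J)) ?fset1U1 //=; congr (_ * _).
rewrite big_seq [RHS]big_seq; apply: eq_bigr => i; rewrite !inE => /andP[/eqP ij _].
by congr (c i _); apply/esym/upd_out.
Qed.

Lemma prodfun_eq c c' j x : (forall i, i <> j -> c i = c' i) ->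
  prodfun c (upd x (1 : G j)%g) = prodfun c' (upd x (1 : G j)%g).
Proof.
move=> cc'; apply: eq_big_seq => i; rewrite in_dsupp.
by have [->|/eqP ij] := eqVneq (i : J) (j : J); rewrite ?upd_in ?eqxx // cc'.
Qed.

Lemma prodfun_le1 c x : (forall i s, normc (c i s) <= 1) -> normc (prodfun c x) <= 1.
Proof.
move=> cle; rewrite /prodfun; elim/big_rec: _ => [|i a _ a1]; first by rewrite normc1.
by rewrite normcM mulr_ile1 ?normc_ge0.
Qed.

Lemma prodfun1 c : prodfun c 1%g = 1.
Proof.
rewrite /prodfun big_seq big1 // => i; rewrite in_dsupp.
by rewrite rp1 eqxx.
Qed.

End ProductFunction.
End RestrictedProduct.

Section Translate.
Variables (R : realType) (G : groupType).
Local Notation C := R[i].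
Implicit Types (g h u : G -> C) (y : G).

Definition rtrans y u : G -> C := fun x => u (x * y^-1)%g.

Let rK y : cancel (fun x : G => x * y^-1)%g (fun x => x * y)%g.
Proof. by move=> x; rewrite mulgVK. Qed.

Let rVK y : cancel (fun x : G => x * y)%g (fun x => x * y^-1)%g.
Proof. exact: mulgK. Qed.

Lemma ell1_rtrans y u : ell1 u -> ell1 (rtrans y u).
Proof. exact: (@ell1_reindex _ _ u _ _ (rK y) (rVK y)). Qed.

Lemma nrm_rtrans y u : nrm (rtrans y u) = nrm u.
Proof. exact: (@nrm_reindex _ _ u _ _ (rK y) (rVK y)). Qed.

Lemma conv_rtrans y g h : convolution g (rtrans y h) = rtrans y (convolution g h).
Proof.
apply/funext => x; rewrite /rtrans !convE; congr csum; apply/funext => z.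
by rewrite mulgA.
Qed.

Lemma csum_rtrans y u (B : G -> C) : ell1 u -> (forall x, normc (B x) <= 1) ->
  csum (rtrans y u * B) = csum (fun x => u x * B (x * y)%g).
Proof.
move=> eu B1; rewrite -[RHS](csum_reindex (rK y) (rVK y)).
  by congr csum; apply/funext => x /=; rewrite mulgVK.
by have [] := @ell1_mulr _ _ u (fun x => B (x * y)%g) 1.
Qed.

End Translate.

(** * Convolution with the central idempotent of one coordinate *)

Section Averaging.
Variables (R : realType) (I : Type) (G : I -> finGroupType).
Local Notation C := R[i].
Local Notation Gp := (restricted_prod G).
Local Notation J := {classic I}.
Variable f : forall i, G i -> C.
Arguments f : clear implicits.
Hypothesis sf : forall i, spherical (f i).
Implicit Types (u v g h : Gp -> C) (i j : I).

Definition idem j (t : G j) : C := (sph_sq (f j))^-1%:C%C * f j t^-1%g.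

(** Right convolution by the idempotent of the factor [G j] (see [conv_lift_idem]), written as a
    finite sum of translates so that linearity can be checked pointwise. *)
Definition conv_idem j u : Gp -> C := \sum_(t : G j) idem t *: rtrans (emb t) u.

Lemma normc_idem j (t : G j) : normc (idem t) = (sph_sq (f j))^-1 * normc (f j t).
Proof.
rewrite normcM normc_real (sphV (sf j)) normc_conj ger0_norm //.
by rewrite invr_ge0 ltW ?sph_sq_gt0.
Qed.

Lemma sum_normc_idem j : \sum_(t : G j) normc (idem t) = sph_norm (f j).
Proof. by rewrite /sph_norm mulr_sumr; apply: eq_bigr => t _; apply: normc_idem. Qed.

Lemma sum_idem j : \sum_(t : G j) f j t * idem t = 1.
Proof.
transitivity ((sph_sq (f j))^-1%:C%C * (sph_sq (f j))%:C%C : C); last first.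
  by rewrite -rmorphM mulVf // gt_eqF ?sph_sq_gt0.
rewrite /sph_sq (rmorph_sum (real_complex R)) mulr_sumr; apply: eq_bigr => t _ /=.
by rewrite /idem (sphV (sf j)) mulrCA mul_conjc.
Qed.

Lemma idemJ j (t s : G j) : idem (t ^ s)%g = idem t.
Proof. by rewrite /idem -conjVg (sph_class (sf j)). Qed.

Lemma conv_idemE j u x : conv_idem j u x = \sum_(t : G j) idem t * u (x * (emb t)^-1)%g.
Proof. by rewrite /conv_idem fct_sumE. Qed.

Lemma conv_idem_le j u : ell1 u ->
  ell1 (conv_idem j u) /\ nrm (conv_idem j u) <= sph_norm (f j) * nrm u.
Proof.
move=> eu; have et (t : G j) : ell1 (idem t *: rtrans (emb t) u).
  by apply: ell1Z; apply: ell1_rtrans.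
have [e le1] := ell1_sum_le (index_enum (G j)) (fun t (_ : xpredT t) => et t).
split=> //; apply: le_trans le1 _; rewrite -sum_normc_idem mulr_suml.
apply: ler_sum => t _; rewrite -(nrm_rtrans (emb t) u).
by apply: nrmZ; apply: ell1_rtrans.
Qed.

Lemma ell1_conv_idem j u : ell1 u -> ell1 (conv_idem j u).
Proof. by move=> eu; have [] := conv_idem_le j eu. Qed.

Lemma classfun_conv_idem j u : classfun_on u -> classfun_on (conv_idem j u).
Proof.
move=> cu x y; rewrite !conv_idemE (reindex_inj (conjg_inj (y j))) /=.
by apply: eq_bigr => t _; rewrite idemJ -embJ -conjVg -conjMg cu.
Qed.

Lemma Zell1_conv_idem j u : Zell1 u -> Zell1 (conv_idem j u).
Proof.
move=> /Zell1P[eu cu]; apply/Zell1P; split; first exact: ell1_conv_idem.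
exact: classfun_conv_idem.
Qed.

Lemma conv_conv_idem j g h : ell1 g -> ell1 h ->
  convolution g (conv_idem j h) = conv_idem j (convolution g h).
Proof.
move=> eg eh; rewrite /conv_idem conv_sumr //; last first.
  by move=> t _; apply: ell1Z; apply: ell1_rtrans.
apply: eq_bigr => t _; rewrite convZr //; last exact: ell1_rtrans.
by rewrite conv_rtrans.
Qed.

Lemma conv_idemD j g h : conv_idem j (g + h) = conv_idem j g + conv_idem j h.
Proof.
apply/funext => x; rewrite fE !conv_idemE -big_split /=.
by apply: eq_bigr => t _; rewrite -mulrDr.
Qed.

Lemma conv_idemZ j c h : conv_idem j (c *: h) = c *: conv_idem j h.
Proof.
apply/funext => x; rewrite fE !conv_idemE mulr_sumr.
by apply: eq_bigr => t _; rewrite mulrCA.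
Qed.

Lemma conv_idem_delta j u : ell1 u -> conv_idem j u = convolution u (conv_idem j (delta R 1%g)).
Proof. by move=> eu; rewrite conv_conv_idem ?convf1 //; apply: ell1_delta. Qed.

(** Each [conv_idem] is convolution by its value at the unit [delta R 1], and these values are
    central. *)
Lemma conv_idemC i j u : ell1 u ->
  conv_idem i (conv_idem j u) = conv_idem j (conv_idem i u).
Proof.
have ed := @ell1_delta R Gp 1%g.
have ei k : ell1 (conv_idem k (delta R 1%g)) by exact: ell1_conv_idem.
have C12 : conv_idem i (conv_idem j (delta R 1%g)) = conv_idem j (conv_idem i (delta R 1%g)).
  rewrite conv_idem_delta // [RHS]conv_idem_delta //; apply: convC => //.
  by apply: classfun_conv_idem; have /Zell1P[] := @Zell1_1 R Gp.
move=> eu; rewrite (conv_idem_delta j eu) (conv_idem_delta i eu).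
by rewrite -!conv_conv_idem // C12.
Qed.

(** Conjugation by elements of [G j] fixes [u] and averages the coefficients, which [sphM] then
    splits. On class functions [conv_idem j] is thus a rank-one projection in the [j]-th
    coordinate. *)
Lemma conv_idem_class j u x : classfun_on u ->
  conv_idem j u x = idem (x j) * \sum_s u (upd x s) * f j s.
Proof.
move=> cu; rewrite conv_idemE.
have E : \sum_(t : G j) idem t * u (x * (emb t)^-1)%g = \sum_s idem (s^-1 * x j)%g * u (upd x s).
  have h1 : injective (fun s => s^-1 * x j)%g.
    by move=> s t /(mulIg (x j)) /invg_inj.
  rewrite (reindex_inj h1) /=; apply: eq_bigr => s _.
  by rewrite embV mul_emb invMg invgK mulKVg.
rewrite E; apply: (mulfI (cardH_neq0 R (G j))).
transitivity (\sum_r \sum_s idem ((s ^ r)^-1 * x j)%g * u (upd x s)).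
  rewrite mulr_natl -sumr_const; apply: eq_bigr => r _.
  rewrite (reindex_inj (conjg_inj r)) /=; apply: eq_bigr => s _.
  by rewrite -[in RHS](cu _ (emb r)) conj_emb upd_upd upd_in.
have avg s : \sum_r idem ((s ^ r)^-1 * x j)%g = #|G j|%:R * (idem (x j) * f j s).
  rewrite /idem -mulr_sumr -mulrA mulrCA; congr (_ * _).
  rewrite -(sphM (sf j)); apply: eq_bigr => r _.
  by rewrite invMg invgK.
rewrite exchange_big 2!mulr_sumr; apply: eq_bigr => s _ /=.
by rewrite -mulr_suml avg; ring.
Qed.

(* The pairing of [conv_idem j u] against a function whose dependence on the
   [j]-th coordinate is [a]: that dependence gets replaced by [f j]. *)
Lemma csum_conv_idem j u (a : G j -> C) (B : Gp -> C) :
  classfun_on u -> ell1 u -> (forall s, normc (a s) <= 1) ->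
  (forall x, normc (B x) <= 1) -> (forall x (s : G j), B (upd x s) = B x) ->
  csum (conv_idem j u * (fun x => a (x j) * B x)) =
  (\sum_s a s * idem s) * csum (u * (fun x => f j (x j) * B x)).
Proof.
move=> cu eu a1 B1 BE.
have bnd (b : G j -> C) (c : R) : 0 <= c -> (forall s, normc (b s) <= c) ->
    forall x : Gp, normc (b (x j) * B x) <= c.
  by move=> c0 bc x; rewrite normcM -[c]mulr1 ler_pM ?normc_ge0.
have aB1 := bnd a 1 ler01 a1.
have su (b : G j -> C) : ell1 (u * (fun x => b (x j) * B x)).
  have c0 : 0 <= \sum_s normc (b s) by apply: sumr_ge0 => s _; apply: normc_ge0.
  have [] // := @ell1_mulr _ _ u _ _ c0 eu (bnd b _ c0 _).
  by move=> s; rewrite (bigD1 s) //= lerDl sumr_ge0 // => i _; apply: normc_ge0.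
(* Shifting the translations from [u] to the test function turns [a] into [K]. Since [u] is a class
   function, [K] may be averaged over conjugation, and [sphM] makes the average a multiple of
   [f j]. *)
pose K (s : G j) := \sum_t idem t * a (s * t)%g.
transitivity (csum (u * (fun x => K (x j) * B x))).
  transitivity (\sum_(t : G j) csum (idem t *: (u * (fun x => a (x j * t)%g * B x)))).
    transitivity (\sum_(t : G j) csum (idem t *: (rtrans (emb t) u * (fun x => a (x j) * B x)))).
      rewrite -csum_sum => [|t _].
        congr csum; apply/funext => x; rewrite fE conv_idemE fct_sumE mulr_suml.
        by apply: eq_bigr => t _; rewrite !fE -mulrA.
      apply: ell1Z; have [] // := @ell1_mulr _ _ (rtrans (emb t) u) _ _ ler01 _ aB1.
      exact: ell1_rtrans.
    apply: eq_bigr => t _; rewrite !csumZ //; first last.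
    - have [] // := @ell1_mulr _ _ (rtrans (emb t) u) _ _ ler01 _ aB1.
      exact: ell1_rtrans.
    - exact: (su (fun s => a (s * t)%g)).
    congr (_ * _); rewrite csum_rtrans //; congr csum; apply/funext => x.
    by rewrite fE mul_emb upd_in BE.
  rewrite -csum_sum => [|t _]; last exact/ell1Z/(su (fun s => a (s * t)%g)).
  congr csum; apply/funext => x; rewrite fct_sumE !fE /K mulr_suml mulr_sumr.
  by apply: eq_bigr => t _; rewrite !fE; ring.
apply: (mulfI (cardH_neq0 R (G j))).
transitivity (\sum_(r : G j) csum (u * (fun x => K (x j ^ r)%g * B x))).
  rewrite mulr_natl -sumr_const; apply: eq_bigr => r _.
  rewrite -(csum_reindex (conjgK (emb r)) (conjgKV (emb r)) (su K)).
  by congr csum; apply/funext => x /=; rewrite !fE cu conj_emb upd_in BE.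
rewrite -csum_sum => [|r _]; last exact: (su (fun s => K (s ^ r)%g)).
rewrite mulrA -[RHS]csumZ; last exact: (su (f j)).
congr csum; apply/funext => x; rewrite fct_sumE !fE.
transitivity (u x * B x * \sum_r K (x j ^ r)%g).
  by rewrite mulr_sumr; apply: eq_bigr => r _; rewrite !fE; ring.
suff -> : \sum_r K (x j ^ r)%g = #|G j|%:R * (\sum_s a s * idem s) * f j (x j) by ring.
transitivity (\sum_s \sum_(r : G j) a s * idem ((x j ^ r)^-1 * s)%g).
  rewrite [RHS]exchange_big; apply: eq_bigr => r _ /=.
  rewrite [RHS](reindex_inj (mulgI (x j ^ r)%g)) /=.
  by apply: eq_bigr => t _; rewrite mulKg mulrC.
rewrite mulr_sumr mulr_suml; apply: eq_bigr => s _.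
rewrite /idem -!mulr_sumr.
have -> : \sum_(r : G j) f j (((x j ^ r)^-1 * s)^-1)%g = #|G j|%:R * (f j s^-1%g * f j (x j)).
  by rewrite -(sphM (sf j)); apply: eq_bigr => r _; rewrite invMg invgK.
by ring.
Qed.

End Averaging.

(** * The multiplicative functional [phi] and finite products of idempotents *)

Section Iterate.
Variables (R : realType) (I : Type) (G : I -> finGroupType).
Local Notation C := R[i].
Local Notation Gp := (restricted_prod G).
Local Notation J := {classic I}.
Variable f : forall i, G i -> C.
Arguments f : clear implicits.
Hypothesis sf : forall i, spherical (f i).
Implicit Types (u v g h : Gp -> C) (i j : I) (S : seq J).
Local Notation d := (@delta R Gp 1%g).

Definition phi u : C := csum (u * prodfun f).

Let f1 i : f i 1%g = 1 := sph1 (sf i).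

Let f_le1 i s : normc (f i s) <= 1 := sph_le1 (sf i) s.

Let F_le1 x : normc (prodfun f x) <= 1.
Proof. exact: prodfun_le1. Qed.

Lemma ell1_mul_prodfun u : ell1 u ->
  ell1 (u * prodfun f) /\ nrm (u * prodfun f) <= nrm u.
Proof. by move=> eu; have := ell1_mulr ler01 eu F_le1; rewrite mul1r. Qed.

Lemma normc_phi u : ell1 u -> normc (phi u) <= nrm u.
Proof.
move=> eu; have [e1 le1] := ell1_mul_prodfun eu.
exact: le_trans (csum_le e1) le1.
Qed.

Lemma phiD u v : ell1 u -> ell1 v -> phi (u + v) = phi u + phi v.
Proof.
move=> eu ev; have [e1 _] := ell1_mul_prodfun eu; have [e2 _] := ell1_mul_prodfun ev.
by rewrite /phi -csumD //; congr csum; apply/funext => x; rewrite !fE mulrDl.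
Qed.

Lemma phiZ c u : ell1 u -> phi (c *: u) = c * phi u.
Proof.
move=> eu; have [e1 _] := ell1_mul_prodfun eu.
by rewrite /phi -csumZ //; congr csum; apply/funext => x; rewrite !fE mulrA.
Qed.

Lemma phiB u v : ell1 u -> ell1 v -> phi (u - v) = phi u - phi v.
Proof.
move=> eu ev; rewrite phiD //; last exact: ell1N.
by rewrite -(scaleN1r v) phiZ // mulN1r.
Qed.

Lemma phi_delta : phi d = 1.
Proof. by rewrite /phi csum_mul_delta prodfun1. Qed.

(** The case [a = f j] of [csum_conv_idem], where the scalar factor is 1 by [sum_idem]. *)
Lemma phi_conv_idem j u : classfun_on u -> ell1 u -> phi (conv_idem f j u) = phi u.
Proof.
move=> cu eu; pose B (x : Gp) := prodfun f (upd x (1 : G j)%g).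
have E : prodfun f = fun x : Gp => f j (x j) * B x.
  by apply/funext => x; rewrite (prodfun_split _ j).
rewrite /phi E csum_conv_idem // ?sum_idem ?mul1r // => x; first exact: F_le1.
by move=> s; rewrite /B upd_upd.
Qed.

Definition conv_idems S u := foldr (conv_idem f) u S.

Lemma ell1_conv_idems S u : ell1 u -> ell1 (conv_idems S u).
Proof. by move=> eu; elim: S => //= j S; apply: ell1_conv_idem. Qed.

Lemma Zell1_conv_idems S u : Zell1 u -> Zell1 (conv_idems S u).
Proof. by move=> eu; elim: S => //= j S; apply: Zell1_conv_idem. Qed.

Lemma nrm_conv_idems S u : ell1 u ->
  nrm (conv_idems S u) <= (\prod_(j <- S) sph_norm (f j)) * nrm u.
Proof.
move=> eu; elim: S => [|j S IH]; first by rewrite big_nil mul1r.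
rewrite big_cons /=; have [_ le1] := conv_idem_le sf j (ell1_conv_idems S eu).
apply: le_trans le1 _; rewrite -mulrA ler_wpM2l // -(sum_normc_idem sf).
by apply: sumr_ge0 => t _; apply: normc_ge0.
Qed.

Lemma conv_conv_idems S g h : ell1 g -> ell1 h ->
  convolution g (conv_idems S h) = conv_idems S (convolution g h).
Proof.
move=> eg eh; elim: S => //= j S <-.
by rewrite conv_conv_idem //; exact: ell1_conv_idems.
Qed.

Lemma conv_idems_delta S u : ell1 u -> conv_idems S u = convolution u (conv_idems S d).
Proof. by move=> eu; rewrite conv_conv_idems ?convf1 //; apply: ell1_delta. Qed.

Lemma conv_idemsD S u v : conv_idems S (u + v) = conv_idems S u + conv_idems S v.
Proof. by elim: S => //= j S ->; rewrite conv_idemD. Qed.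

Lemma conv_idemsC S j u : ell1 u ->
  conv_idems S (conv_idem f j u) = conv_idem f j (conv_idems S u).
Proof.
move=> eu; elim: S => //= i S ->.
by rewrite (conv_idemC sf) //; exact: ell1_conv_idems.
Qed.

Lemma phi_conv_idems S u : Zell1 u -> phi (conv_idems S u) = phi u.
Proof.
move=> zu; elim: S => //= j S <-.
by have /Zell1P[e c] := Zell1_conv_idems S zu; rewrite phi_conv_idem.
Qed.

Definition supported_in S u := forall x : Gp, u x != 0 -> forall i, x i != 1%g -> (i : J) \in S.

(* Integrates out the [j]-th coordinate, so that [conv_idem j (slice j u) = conv_idem j u]. *)
Definition slice j u : Gp -> C :=
  fun x => (x j == 1%g)%:R * \sum_s u (upd x s) * f j s.

Lemma Zell1_slice j u : Zell1 u -> Zell1 (slice j u).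
Proof.
move=> /Zell1P[eu cu]; apply/Zell1P; split.
  pose w : Gp -> C := \sum_(s : G j) f j s *: rtrans (emb s)^-1%g u.
  have ew : ell1 w by apply: ell1_sum => s _; apply/ell1Z/ell1_rtrans.
  have -> : slice j u = w * (fun x : Gp => (x j == 1%g)%:R).
    apply/funext => x; rewrite /slice fE mulrC; case: eqP => xj; last by rewrite !mulr0.
    rewrite !mulr1 /w fct_sumE; apply: eq_bigr => s _.
    by rewrite fE /rtrans invgK mul_emb xj mul1g mulrC.
  have [] // := @ell1_mulr _ _ w (fun x : Gp => (x j == 1%g)%:R) 1 ler01 ew.
  by move=> x; case: (_ == _); rewrite ?normc0 ?normc1.
move=> x y; rewrite /slice rpJ -{1}(conj1g (y j)) (inj_eq (conjg_inj _)).
congr (_ * _); rewrite (reindex_inj (conjg_inj (y j))) /=; apply: eq_bigr => s _.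
by rewrite -upd_conj cu (sph_class (sf j)).
Qed.

Lemma conv_idem_slice j u : Zell1 u -> conv_idem f j (slice j u) = conv_idem f j u.
Proof.
move=> zu; have /Zell1P[_ cu] := zu; have /Zell1P[_ cs] := Zell1_slice j zu.
apply/funext => x; rewrite !(conv_idem_class sf) //; congr (_ * _).
rewrite (bigD1 1%g) //= big1 => [|s /negPf s1]; last first.
  by rewrite /slice upd_in s1 mul0r mul0r.
rewrite addr0 f1 mulr1 /slice upd_in eqxx mul1r; apply: eq_bigr => s _.
by rewrite upd_upd.
Qed.

Lemma slice_supported j S u : supported_in (j :: S) u -> supported_in S (slice j u).
Proof.
move=> uS x; rewrite /slice; case: (x j =P 1%g) => xj; last by rewrite mul0r eqxx.
rewrite mul1r => nz i xi; have ij : i <> j by move=> ij; move: xi; rewrite ij xj eqxx.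
have [s us] : exists s : G j, u (upd x s) != 0.
  apply: contrapT => no; case/eqP: nz; rewrite big1 // => s _.
  by have [->|nz] := eqVneq (u (upd x s)) 0; [rewrite mul0r | case: no; exists s].
by have := uS _ us i; rewrite upd_out // inE => /(_ xi) /orP[/eqP|].
Qed.

(** Induction on [S]: under [conv_idem j], the function [u] may be replaced by [slice j u], which
    lives on the remaining coordinates and has the same [phi]. With no coordinates left, [u] is a
    multiple of the unit. *)
Lemma conv_idems_supported S u : Zell1 u -> supported_in S u ->
  conv_idems S u = phi u *: conv_idems S d.
Proof.
elim: S u => [|j S IH] u zu uS.
  have uE : u = u 1%g *: d.
    apply/funext => x; rewrite fE /delta; case: (x =P 1%g) => [->|x1]; rewrite ?mulr1 // mulr0.
    apply: contrapT => /eqP nz; apply: x1; apply: rp_ext => i.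
    by apply: contrapT => /eqP xi; have := uS x nz i xi.
  rewrite {1}uE /=; congr (_ *: _).
  by rewrite uE phiZ ?phi_delta ?mulr1 ?fE /delta ?eqxx ?mulr1 //; exact: ell1_delta.
have zs := Zell1_slice j zu; have /Zell1P[es cs] := zs; have /Zell1P[eu cu] := zu.
rewrite /= -conv_idemsC // -conv_idem_slice // conv_idemsC //.
rewrite IH //; last exact: slice_supported.
by rewrite -(phi_conv_idem j cs es) conv_idem_slice // phi_conv_idem // conv_idemZ.
Qed.

Lemma dsuppJ (x y : Gp) : dsupp (x ^ y)%g = dsupp x.
Proof.
apply/fsetP => i; rewrite !in_dsupp rpJ -{1}(conj1g (y i)).
by rewrite (inj_eq (conjg_inj _)).
Qed.

Definition restrict (S : {fset J}) u : Gp -> C :=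
  fun x => if (dsupp x `<=` S)%fset then u x else 0.

Lemma restrict_supported (S : {fset J}) u : supported_in S (restrict S u).
Proof.
move=> x; rewrite /restrict; case: ifP => [xS _ i xi|_]; last by rewrite eqxx.
by apply: (fsubsetP xS); rewrite in_dsupp.
Qed.

Lemma Zell1_restrict (S : {fset J}) u : Zell1 u -> Zell1 (restrict S u).
Proof.
move=> /Zell1P[eu cu]; apply/Zell1P; split; last first.
  by move=> x y; rewrite /restrict dsuppJ cu.
have [] // := @ell1_le _ _ (restrict S u) u 1 ler01 eu.
by move=> x; rewrite mul1r /restrict; case: ifP; rewrite // normc0 normc_ge0.
Qed.

Lemma restrict_approx u (e : R) : ell1 u -> 0 < e ->
  exists S : {fset J}, forall S' : {fset J}, (S `<=` S')%fset -> nrm (u - restrict S' u) <= e.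
Proof.
move=> eu e0; have [A HA] := esum_approx (fun x => normc_ge0 (u x)) (ell1_normE eu) e0.
(* [A] carries all but [e] of the norm of [u], and [S] collects the coordinates occurring in [A]. *)
pose S := (\bigcup_(x <- A) dsupp x)%fset; exists S => S' SS'.
apply: (proj2 (ell1_fset_bound (M := e) _)) => B.
have inS' x : x \in A -> (dsupp x `<=` S')%fset.
  move=> xA; apply: fsubset_trans SS'; exact: (@bigfcup_sup _ _ _ _ xpredT).
apply: (@le_trans _ _ (\sum_(x <- (B `\` A)%fset) normc (u x))).
  rewrite (big_fsetID _ (mem A) B) /= big1_seq ?add0r => [|x]; last first.
    rewrite !inE => /andP[_ /andP[_ xA]]; rewrite !fE /restrict inS' // subrr; exact: normc0.
  rewrite (_ : [fset x in B | x \notin A]%fset = (B `\` A)%fset); last first.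
    by apply/fsetP => x; rewrite !inE andbC.
  apply: ler_sum => x _; rewrite !fE /restrict; case: ifP; rewrite ?subrr ?subr0 //.
  by rewrite normc0 normc_ge0.
have /andP[lt_A _] := HA A (fsubset_refl _).
have := ell1_fset_le (A `|` B)%fset eu.
rewrite (big_fsetID _ (mem A)) /=.
rewrite (_ : [fset x in (A `|` B)%fset | x \in A]%fset = A); last first.
  by apply/fsetP => x; rewrite !inE; case: (x \in A); rewrite ?andbF.
rewrite (_ : [fset x in (A `|` B)%fset | x \notin A]%fset = (B `\` A)%fset); last first.
  by apply/fsetP => x; rewrite !inE; case: (x \in A); rewrite ?andbF ?andbT.
by move: lt_A; lra.
Qed.

(** If [h] involves only coordinates in [S], then applying the idempotents of [S] to
    [convolution g h] keeps [phi] and, by [conv_idems_supported], turns [h] into [phi h] times their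
    product. The general case follows by approximation. *)
Lemma phi_conv g h : Zell1 g -> Zell1 h -> phi (convolution g h) = phi g * phi h.
Proof.
move=> zg zh; have eg := Zell1_ell1 zg; have eh := Zell1_ell1 zh.
apply/eqP; rewrite -subr_eq0 -normc_eq0 eq_le normc_ge0 andbT.
apply/ler_addgt0Pr => e e0; rewrite add0r.
(* Each of the two error terms is at most [nrm g * nrm h2]; adding 1 keeps the denominator
   positive. *)
pose e' := e / (2 * nrm g + 1).
have g0 : 0 < 2 * nrm g + 1 by rewrite ltr_wpDl // mulr_ge0 ?nrm_ge0.
have [S [h1 [z1 S1 HS]]] : exists (S : {fset J}) (h1 : Gp -> C),
    [/\ Zell1 h1, supported_in S h1 & nrm (h - h1) <= e'].
  have [S HS] := restrict_approx eh (divr_gt0 e0 g0).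
  exists S, (restrict S h); split; [exact: Zell1_restrict | exact: restrict_supported |].
  exact: HS (fsubset_refl _).
have e1 := Zell1_ell1 z1; have := ell1B eh e1.
have : h = h1 + (h - h1) by rewrite addrC subrK.
move: (h - h1) HS => h2 HS hE e2.
have egh1 := ell1_conv eg e1; have egh2 := ell1_conv eg e2.
have E1 : phi (convolution g h1) = phi g * phi h1.
  rewrite -(phi_conv_idems S); last exact: Zell1_conv.
  rewrite -conv_conv_idems // conv_idems_supported //.
  have ed : ell1 (conv_idems S d) by apply/ell1_conv_idems/ell1_delta.
  rewrite convZr // phiZ; last exact: ell1_conv.
  by rewrite -conv_idems_delta // phi_conv_idems // mulrC.
have -> : phi (convolution g h) - phi g * phi h = phi (convolution g h2) - phi g * phi h2.
  have -> : convolution g h = convolution g h1 + convolution g h2 by rewrite hE convDr.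
  have -> : phi h = phi h1 + phi h2 by rewrite hE phiD.
  by rewrite phiD // E1; ring.
rewrite (le_trans (ler_normcB _ _)) //.
have le1 : normc (phi (convolution g h2)) <= nrm g * nrm h2.
  exact: le_trans (normc_phi egh2) (nrm_conv eg e2).
have le2 : normc (phi g * phi h2) <= nrm g * nrm h2.
  by rewrite normcM ler_pM ?normc_ge0 ?normc_phi.
have : (2 * nrm g + 1) * nrm h2 <= e by rewrite mulrC -ler_pdivlMr.
have := nrm_ge0 h2; move: le1 le2; lra.
Qed.

(** The kernel has codimension one: with any [k] such that [phi k <> 0] it spans the centre. *)
Lemma phi_kernel_maximal : maximal_ideal [set u | Zell1 u /\ phi u = 0].
Proof.
split.
- split=> [u []//| | a g h [zg g0] [zh h0]|g h zg [zh h0]].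
  + split; first exact: Zell1_0.
    rewrite /phi (_ : _ * _ = 0) ?csum0 //.
    by apply/funext => x; rewrite !fE mul0r.
  + have za := Zell1Z a zg.
    split; first exact: (Zell1D za zh).
    rewrite -[X in phi X]/(a *: g + h) phiD ?phiZ ?g0 ?h0 ?mulr0 ?addr0 //; try exact: Zell1_ell1.
  + by split; [exact: Zell1_conv | rewrite phi_conv // h0 mulr0].
- move=> E; have : [set u | Zell1 u /\ phi u = 0] d by rewrite E; exact: Zell1_1.
  by move=> [_]; rewrite phi_delta => /eqP; rewrite oner_eq0.
move=> K [KZ K0 KD Kc] JK.
have [sub|nsub] := pselect (K `<=` [set u | Zell1 u /\ phi u = 0]).
  by left; apply/seteqP; split.
right; apply/seteqP; split=> // w zw.
have [k [Kk pk]] : exists k, K k /\ phi k <> 0.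
  apply: contrapT => no; apply: nsub => k Kk; split; first exact: KZ.
  by apply: contrapT => pk; apply: no; exists k.
have ek := Zell1_ell1 (KZ _ Kk); have ew := Zell1_ell1 zw.
pose c := phi w / phi k.
have wE : w = (fun x => c * k x + (w - c *: k) x).
  by apply/funext => x; rewrite !fE addrC subrK.
rewrite wE; apply: KD => //; apply: JK; split.
  by apply: Zell1B => //; apply: Zell1Z; exact: KZ.
rewrite phiB ?phiZ //; last exact: ell1Z.
by rewrite /c divfK ?subrr //; apply/eqP.
Qed.

End Iterate.

(** * A lower bound for approximate identities of the kernel of [phi] *)

Section LowerBound.
Variables (R : realType) (I : Type) (G : I -> finGroupType).
Local Notation C := R[i].
Local Notation Gp := (restricted_prod G).
Local Notation J := {classic I}.
Variable f : forall i, G i -> C.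
Arguments f : clear implicits.
Hypothesis sf : forall i, spherical (f i).
Implicit Types (u v g h : Gp -> C) (i j : I) (S : seq J).
Local Notation d := (@delta R Gp 1%g).

(** This is 0 where [f i] vanishes and unimodular elsewhere; pairing it with [idem] produces the
    norm of the idempotent. *)
Definition phase i (s : G i) : C := f i s / (normc (f i s))%:C%C.

Lemma phase1 i : phase (1 : G i)%g = 1.
Proof. by rewrite /phase (sph1 (sf i)) normc1 divr1. Qed.

Lemma phase_le1 i (s : G i) : normc (phase s) <= 1.
Proof.
rewrite /phase normcM normcV normc_real ger0_norm ?normc_ge0 //.
have [->|nz] := eqVneq (normc (f i s)) 0; first by rewrite mul0r.
by rewrite divff.
Qed.

Lemma sum_phase_idem i : \sum_(s : G i) phase s * idem f s = (sph_norm (f i))%:C%C.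
Proof.
rewrite -(sum_normc_idem sf) rmorph_sum; apply: eq_bigr => s _ /=.
rewrite (normc_idem sf) /phase /idem (sphV (sf i)) mulrCA mulrAC mul_conjc.
rewrite [RHS](rmorphM (real_complex R)); congr (_ * _).
have [->|nz] := eqVneq (normc (f i s)) 0; first by rewrite expr0n mul0r.
by rewrite expr2 (rmorphM (real_complex R)) mulfK // (fmorph_eq0 (real_complex R)).
Qed.

Definition phase_on S i : G i -> C := if (i : J) \in S then @phase i else f i.

Lemma phase_on1 S i : phase_on S (1 : G i)%g = 1.
Proof. by rewrite /phase_on; case: ifP => _; [exact: phase1 | exact: sph1 (sf i)]. Qed.

Lemma phase_on_le1 S i (s : G i) : normc (phase_on S s) <= 1.
Proof. by rewrite /phase_on; case: ifP => _; [exact: phase_le1 | exact: (sph_le1 (sf i))]. Qed.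

(** By [csum_conv_idem], removing the idempotent at [j] costs the factor [sph_norm (f j)] and
    replaces the phase at [j] by [f j]. As [S] has no repetition, what remains is the test function
    for the tail, and for empty [S] the pairing is [phi]. *)
Lemma csum_conv_idems_phase S u : uniq S -> Zell1 u ->
  csum (conv_idems f S u * prodfun (phase_on S)) =
  (\prod_(j <- S) sph_norm (f j))%:C%C * phi f u.
Proof.
move=> + zu; elim: S => [_|j S IH /= /andP[jS uS]].
  rewrite big_nil mul1r /phi; congr (csum (_ * prodfun _)).
have /Zell1P[eS cS] := Zell1_conv_idems sf S zu.
pose B (x : Gp) := prodfun (phase_on (j :: S)) (upd x (1 : G j)%g).
have E : prodfun (phase_on (j :: S)) = fun x : Gp => phase (x j) * B x.
  apply/funext => x; rewrite (prodfun_split _ j); last exact: phase_on1.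
  by rewrite {1}/phase_on inE eqxx.
rewrite E (csum_conv_idem sf) //; first last.
- by move=> x s; rewrite /B upd_upd.
- by move=> x; apply: prodfun_le1 => i s; apply: phase_on_le1.
- exact: phase_le1.
rewrite sum_phase_idem big_cons [in RHS](rmorphM (real_complex R)) -[RHS]mulrA -IH //.
congr (_ * csum (_ * _)).
apply/funext => x; rewrite [RHS](prodfun_split _ j); last exact: phase_on1.
rewrite {1}/phase_on (negPf jS) /B; congr (_ * _); apply: prodfun_eq => i ij.
by rewrite /phase_on inE; case: eqP.
Qed.

Lemma kernel_bai_bound :
  has_bai [set u | Zell1 u /\ phi f u = 0] ->
  exists M : R, forall S, uniq S -> \prod_(j <- S) sph_norm (f j) <= M.
Proof.
move=> [A [le [h [[[[a0] le_refl _ _] hJ happ] hfin]]]].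
have nh0 : (0 <= net_norm h)%E.
  by apply: ereal_sup_ge => //; exists (ell1_norm (h a0)); [exists a0 | exact: ell1_norm_ge0].
pose M := fine (net_norm h).
have hM a : nrm (h a) <= M.
  have za : Zell1 (h a) by have [] := hJ a.
  rewrite -lee_fin -ell1_normE; last exact: Zell1_ell1.
  rewrite /M fineK ?ge0_fin_numE //; apply: ereal_sup_ubound.
  by exists a.
(* [M] bounds the pairing with [h a], and 1 bounds both the pairing with [d] and the approximation
   error at [d - E]. *)
exists (M + 2) => S uS.
have ed := @ell1_delta R Gp 1%g.
have zd := @Zell1_1 R Gp.
pose E := conv_idems f S d.
have zE : Zell1 E by exact: Zell1_conv_idems.
have JE : [set u | Zell1 u /\ phi f u = 0] (d - E).
  split; first exact: Zell1B.
  by rewrite phiB //; [rewrite /E phi_conv_idems // subrr | exact: Zell1_ell1].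
have [a /(_ a (le_refl a)) lt1] := happ _ JE 1 ltr01.
have [za pa] := hJ a; have ea := Zell1_ell1 za; have eE := Zell1_ell1 zE.
have edE : ell1 (d - E) by exact: ell1B.
have {}lt1 : nrm (convolution (h a) (d - E) - (d - E)) <= 1.
  have e1 : ell1 (convolution (h a) (d - E) - (d - E)).
    by apply: ell1B => //; apply: ell1_conv.
  by rewrite -lee_fin -ell1_normE //; apply: ltW.
set P := \prod_(j <- S) _.
pose b := prodfun (phase_on S) : Gp -> C.
have b1 x : normc (b x) <= 1 by apply: prodfun_le1 => i s; apply: phase_on_le1.
have eb u : ell1 u -> ell1 (u * b) by move=> eu; have [] := ell1_mulr ler01 eu b1.
have nb u : ell1 u -> normc (csum (u * b)) <= nrm u.
  move=> eu; have [e1 le1] := ell1_mulr ler01 eu b1.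
  by rewrite mul1r in le1; apply: le_trans (csum_le e1) le1.
have bB u v : ell1 u -> ell1 v -> csum ((u - v) * b) = csum (u * b) - csum (v * b).
  move=> eu ev; rewrite -csumB; try exact: eb.
  by congr csum; apply/funext => x; rewrite !fE mulrBl.
have hE : convolution (h a) (d - E) - (d - E) = h a - conv_idems f S (h a) - (d - E).
  by rewrite convBr // convf1 /E conv_conv_idems // convf1.
have esh : ell1 (conv_idems f S (h a)) by exact: ell1_conv_idems.
have := nb _ (ell1B (ell1B ea esh) edE); rewrite -hE => le2.
have {}le2 := le_trans le2 lt1.
(* The term of [E] applied to [h a] vanishes because [phi (h a) = 0], whereas [E] itself contributes
   [P] because [phi d = 1]. *)
have EQ : csum ((convolution (h a) (d - E) - (d - E)) * b) =
    csum (h a * b) - csum (d * b) + P%:C%C.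
  rewrite hE bB ?bB //; last exact: ell1B.
  rewrite /E !csum_conv_idems_phase // pa mulr0 subr0 phi_delta mulr1.
  by rewrite opprB addrA addrAC.
have : normc (P%:C%C : C) <= normc (csum ((convolution (h a) (d - E) - (d - E)) * b)) +
    (normc (csum (h a * b)) + normc (csum (d * b))).
  have -> : P%:C%C = csum ((convolution (h a) (d - E) - (d - E)) * b) -
      (csum (h a * b) - csum (d * b)) by rewrite EQ addrC addKr.
  apply: le_trans (ler_normcB _ _) _; rewrite lerD2l; exact: ler_normcB.
rewrite normc_real => le3; have := ler_norm P.
have := nb _ ea; have := hM a; have := nb _ ed; have := nrm_delta R (1%g : Gp).
by move: le2 le3; lra.
Qed.

End LowerBound.

(** * Maximal ideals *)

Section HermitianEigenvalue.
Variables (R : realType) (n : nat) (A : 'M[R[i]]_n).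
Hypothesis Aherm : forall i k, A k i = conjc (A i k).

Lemma hermitian_eigenvalue_real z : eigenvalue A z -> conjc z = z.
Proof.
move=> /eigenvalueP[v vA nzv].
pose N : R[i] := \sum_k v 0 k * conjc (v 0 k).
pose S : R[i] := \sum_k (v *m A) 0 k * conjc (v 0 k).
have NE : N = (\sum_k normc (v 0 k) ^+ 2)%:C%C.
  by rewrite /N rmorph_sum; apply: eq_bigr => k _; rewrite mul_conjc.
have N0 : N != 0.
  rewrite NE (fmorph_eq0 (real_complex R)); apply: contra nzv => /eqP /psumr_eq0P H.
  apply/eqP/rowP => k; have /eqP := H (fun l _ => sqr_ge0 _) k isT.
  by rewrite expf_eq0 normc_eq0 mxE => /eqP.
have SE : S = z * N.
  by rewrite /S vA mulr_sumr; apply: eq_bigr => k _; rewrite mxE mulrA.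
have cN : conjc N = N by rewrite NE conjc_real.
have cS : conjc S = S.
  rewrite /S rmorph_sum /=.
  under eq_bigr do rewrite mxE rmorphM /= conjcK mulrC rmorph_sum mulr_sumr.
  under [RHS]eq_bigr do rewrite mxE mulr_suml.
  rewrite exchange_big; apply: eq_bigr => k _; apply: eq_bigr => l _.
  by rewrite rmorphM /= -Aherm; ring.
by apply: (mulIf N0); rewrite -SE -cS SE rmorphM /= cN.
Qed.

End HermitianEigenvalue.

(** * Functions on one factor, viewed in the full algebra *)

Section Lift.
Variables (R : realType) (I : Type) (G : I -> finGroupType).
Local Notation C := R[i].
Local Notation Gp := (restricted_prod G).
Implicit Types (u v g h : Gp -> C) (j : I).
Local Notation d := (@delta R Gp 1%g).

Definition lift j (a : G j -> C) : Gp -> C := \sum_s a s *: delta R (emb s).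

Lemma ell1_lift j (a : G j -> C) : ell1 (lift a).
Proof. by apply: ell1_sum => s _; apply/ell1Z/ell1_delta. Qed.

Lemma conv_lift j (a : G j -> C) u : ell1 u ->
  convolution u (lift a) = \sum_s a s *: rtrans (emb s) u.
Proof.
move=> eu; rewrite conv_sumr //; last by move=> s _; apply/ell1Z/ell1_delta.
apply: eq_bigr => s _; rewrite convZr //; last exact: ell1_delta.
by rewrite conv_deltar.
Qed.

Lemma conv_lift_idem (f : forall i, G i -> C) j u : ell1 u ->
  convolution u (lift (@idem R I G f j)) = conv_idem f j u.
Proof. exact: conv_lift. Qed.

(** Convolving with [lift a] on the right is a finite combination of right translations, and these
    commute with convolution on the left. *)
Lemma convA_lift j (a : G j -> C) g h : ell1 g -> ell1 h ->
  convolution g (convolution h (lift a)) = convolution (convolution g h) (lift a).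
Proof.
move=> eg eh; rewrite !conv_lift //; last exact: ell1_conv.
rewrite conv_sumr //; last by move=> s _; apply/ell1Z/ell1_rtrans.
apply: eq_bigr => s _; rewrite convZr ?conv_rtrans //; exact: ell1_rtrans.
Qed.

Lemma liftD j (a b : G j -> C) : lift (fun s => a s + b s) = lift a + lift b.
Proof. by rewrite /lift -big_split; apply: eq_bigr => s _; rewrite scalerDl. Qed.

Lemma liftZ j c (a : G j -> C) : lift (fun s => c * a s) = c *: lift a.
Proof. by rewrite /lift scaler_sumr; apply: eq_bigr => s _; rewrite scalerA. Qed.

Lemma lift_delta j (t : G j) : lift (fun s => (s == t)%:R) = delta R (emb t).
Proof.
rewrite /lift (bigD1 t) //= eqxx scale1r big1 ?addr0 // => s /negPf->.
by rewrite scale0r.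
Qed.

Lemma lift_classfun j (a : G j -> C) : (forall s t, a (s ^ t)%g = a s) ->
  Zell1 (lift a).
Proof.
move=> ca; apply/Zell1P; split; first exact: ell1_lift.
move=> x y; rewrite /lift !fct_sumE (reindex_inj (conjg_inj (y j))) /=.
by apply: eq_bigr => s _; rewrite !fE ca /delta -embJ (inj_eq (conjg_inj y)).
Qed.

Lemma conv_lift_lift j (a b : G j -> C) :
  convolution (lift a) (lift b) = lift (fun z => \sum_s a s * b (s^-1 * z)%g).
Proof.
rewrite conv_lift; last exact: ell1_lift.
rewrite {2}/lift; under [RHS]eq_bigr do rewrite scaler_suml.
rewrite exchange_big /=.
transitivity (\sum_t \sum_s (a s * b t) *: delta R (emb (s * t)%g)).
  apply: eq_bigr => t _; apply/funext => x.
  rewrite fE /rtrans /lift !fct_sumE mulr_sumr; apply: eq_bigr => s _.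
  by rewrite !fE /delta embM -(inj_eq (mulIg (emb t))) mulgVK; ring.
rewrite exchange_big; apply: eq_bigr => s _ /=.
rewrite [RHS](reindex_inj (mulgI s)) /=; apply: eq_bigr => t _.
by rewrite mulKg.
Qed.

End Lift.

(** * Primality and scalars modulo a maximal ideal *)

Section MaximalIdeal.
Variables (R : realType) (I : Type) (G : I -> finGroupType).
Local Notation C := R[i].
Local Notation Gp := (restricted_prod G).
Implicit Types (u v w g h : Gp -> C) (j : I).
Local Notation d := (@delta R Gp 1%g).
Variable K : set (Gp -> C).
Hypothesis maxK : maximal_ideal K.

Let idK : ideal K. Proof. by have [] := maxK. Qed.

Lemma ideal_Zell1 u : K u -> Zell1 u.
Proof. by have [KZ _ _ _] := idK; apply: KZ. Qed.

Lemma ideal0 : K 0. Proof. by have [_ K0 _ _] := idK; exact: K0. Qed.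

Lemma idealD u v : K u -> K v -> K (u + v).
Proof.
move=> Ku Kv; have [_ _ KD _] := idK; have := KD 1 u v Ku Kv.
by congr K; apply/funext => x; rewrite mul1r.
Qed.

Lemma idealZ c u : K u -> K (c *: u).
Proof.
move=> Ku; have [_ _ KD _] := idK; have := KD c u 0 Ku ideal0.
by congr K; apply/funext => x; rewrite addr0.
Qed.

Lemma idealB u v : K u -> K v -> K (u - v).
Proof. by move=> Ku Kv; rewrite -(scaleN1r v); apply: idealD => //; apply: idealZ. Qed.

Lemma ideal_convl u v : Zell1 u -> K v -> K (convolution u v).
Proof. by have [_ _ _ Kc] := idK; apply: Kc. Qed.

Lemma ideal_convr u v : K u -> Zell1 v -> K (convolution u v).
Proof.
move=> Ku zv; have [eu cu] := ideal_Zell1 Ku; rewrite cu; last exact: Zell1_ell1.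
exact: ideal_convl.
Qed.

Lemma maximal_ideal_proper : ~ K d.
Proof.
move=> Kd; have [_ KZ _] := maxK; apply: KZ; apply/seteqP; split=> u.
  exact: ideal_Zell1.
by move=> zu; rewrite -(convf1 u); apply: ideal_convl.
Qed.

(** If [lift b] is not in [K], then [K] and [lift b] generate the unit: [d = m + z * lift b] with
    [m] in [K]. Multiplying by [w] gives [w = w * m + z * (w * lift b)]. Taking one factor of the
    form [lift b] lets [convA_lift] supply associativity. *)
Lemma maximal_ideal_prime j (b : G j -> C) w :
  (forall s t, b (s ^ t)%g = b s) -> Zell1 w ->
  K (convolution w (lift b)) -> K w \/ K (lift b).
Proof.
move=> cb zw Kwb; have zb := lift_classfun cb.
have [Kb|nKb] := pselect (K (lift b)); [by right | left].
have eb := ell1_lift b.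
pose L : set (Gp -> C) := [set u | exists m z, [/\ K m, Zell1 z & u = m + convolution z (lift b)]].
have idL : ideal L.
  split=> [_ [m [z [Km zz ->]]]|
          |c _ _ [m [z [Km zz ->]]] [m' [z' [Km' zz' ->]]]
          |g _ zg [m [z [Km zz ->]]]].
  - by apply: Zell1D; [exact: ideal_Zell1 | exact: Zell1_conv].
  - exists 0, 0; split; [exact: ideal0 | exact: Zell1_0 |].
    by rewrite add0r conv_lift ?big1 // => [s _|]; [exact: scaler0 | exact: ell1_0].
  - exists (c *: m + m'), (c *: z + z'); split.
    + by apply: idealD => //; apply: idealZ.
    + by apply: Zell1D => //; apply: Zell1Z.
    have [ez ez'] := (Zell1_ell1 zz, Zell1_ell1 zz').
    rewrite convDl //; last exact: ell1Z.
    by rewrite convZl //; apply/funext => x; rewrite !fE; ring.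
  exists (convolution g m), (convolution g z); split.
  + exact: ideal_convl.
  + exact: Zell1_conv.
  have [eg ez] := (Zell1_ell1 zg, Zell1_ell1 zz).
  have em := Zell1_ell1 (ideal_Zell1 Km).
  by rewrite convDr ?convA_lift //; exact: ell1_conv.
have KL : K `<=` L.
  move=> m Km; exists m, 0; split=> //; first exact: Zell1_0.
  by rewrite conv_lift ?big1 ?addr0 // => [s _|]; [exact: scaler0 | exact: ell1_0].
have [_ _ /(_ L idL KL)[LK|LZ]] := maxK.
  case: nKb; rewrite -LK; exists 0, d; split; [exact: ideal0 | exact: Zell1_1 |].
  by rewrite add0r conv1f.
have [m [z [Km zz dE]]] : L d by rewrite LZ; exact: Zell1_1.
have [ew cw] := zw; have ez := Zell1_ell1 zz; have em := Zell1_ell1 (ideal_Zell1 Km).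
rewrite -(convf1 w) dE convDr //; last exact: ell1_conv.
apply: idealD; first exact: ideal_convl.
rewrite convA_lift // cw // -convA_lift //.
exact: ideal_convl.
Qed.

(** Convolution by [a] on [G j] is a finite matrix whose characteristic polynomial splits. By
    Cayley-Hamilton the product of the factors [lift a - z *: d] over its roots is 0, so by
    primality one factor lies in [K]. A Hermitian [a] gives a Hermitian matrix, whose roots are
    real. *)
Lemma ideal_eigenvalue j (a : G j -> C) :
  (forall s t, a (s ^ t)%g = a s) ->
  exists2 z, K (lift a - z *: d) &
    (forall s, a s^-1%g = conjc (a s)) -> conjc z = z.
Proof.
move=> ca; have ea := ell1_lift a; have ed := @ell1_delta R Gp 1%g.
have [n cardG] : exists n, #|G j| = n.+1.
  by exists #|G j|.-1; rewrite prednK //; apply/card_gt0P; exists 1%g.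
pose e (i : 'I_n.+1) : G j := enum_val (cast_ord (esym cardG) i).
pose e' (s : G j) : 'I_n.+1 := cast_ord cardG (enum_rank s).
have eK : cancel e e' by move=> i; rewrite /e /e' enum_valK cast_ordKV.
have e'K : cancel e' e by move=> s; rewrite /e /e' cast_ordK enum_rankK.
pose A : 'M[C]_n.+1 := \matrix_(i, k) a ((e i)^-1 * e k)%g.
have [r rE] := closed_field_poly_normal (char_poly A).
have {}rE : char_poly A = \prod_(z <- r) ('X - z%:P).
  by rewrite rE (monicP (char_poly_monic A)) scale1r.
pose vlift (v : 'rV[C]_n.+1) := lift (fun s => v 0 (e' s)).
have vliftA (v : 'rV[C]_n.+1) z :
    convolution (vlift v) (lift a) - z *: vlift v = vlift (v *m (A - z%:M)).
  rewrite conv_lift_lift -scaleN1r -!liftZ -liftD; congr lift; apply/funext => s.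
  rewrite mulmxBr mul_mx_scalar !mxE mulN1r; congr (_ - _).
  rewrite (reindex e) /=; last by exists e'.
  by apply: eq_bigr => i _; rewrite eK !mxE e'K.
(* [p l] is the product of the factors [lift a - z *: d] for [z] in [l], as [p0] and [pS] show; for
   [l = r] it is 0. *)
pose p (l : seq C) := vlift (delta_mx 0 (e' 1%g) *m horner_mx A (\prod_(z <- l) ('X - z%:P))).
have p0 : p [::] = d.
  rewrite /p big_nil rmorph1 mulmx1 -(@emb1 I G j) -lift_delta; congr lift; apply/funext => s.
  by rewrite mxE eqxx (can_eq e'K).
have pS z l : p (z :: l) = convolution (p l) (lift a - z *: d).
  rewrite convBr //; [|exact: ell1_lift|exact: ell1Z].
  rewrite convZr ?convf1 //; last exact: ell1_lift.
  rewrite vliftA /p big_cons mulrC rmorphM /= -mulmxE mulmxA; congr (vlift (_ *m _)).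
  by rewrite rmorphB /= horner_mx_X horner_mx_C.
have pr : p r = 0.
  rewrite /p -rE Cayley_Hamilton mulmx0 /vlift -[RHS](scale0r d) -(@emb1 I G j).
  rewrite /lift big1 ?scale0r // => s _; by rewrite mxE scale0r.
have zd := @Zell1_1 R Gp.
have zl z : Zell1 (lift a - z *: d).
  by apply: Zell1B; [exact: lift_classfun | exact: Zell1Z].
have zp l : Zell1 (p l).
  by elim: l => [|z l IH]; [rewrite p0 | rewrite pS; apply: Zell1_conv].
have lE z : lift a - z *: d = lift (fun s => a s - z * (s == 1%g)%:R).
  rewrite -(@emb1 I G j) -lift_delta -scaleN1r -!liftZ -liftD.
  by congr lift; apply/funext => s; rewrite mulN1r.
have find l : K (p l) -> exists2 z, z \in l & K (lift a - z *: d).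
  elim: l => [|z l IH]; first by rewrite p0 => /maximal_ideal_proper.
  rewrite pS lE => /maximal_ideal_prime[|//|/IH[y yl Ky]|Kz].
  - by move=> s t; rewrite ca -{1}(conj1g t) (inj_eq (conjg_inj t)).
  - by exists y; rewrite // inE yl orbT.
  - by exists z; rewrite ?lE // inE eqxx.
have [z zr Kz] := find r (eq_ind_r K ideal0 pr).
exists z => // herm; apply: (@hermitian_eigenvalue_real _ _ A).
  by move=> i k; rewrite !mxE -herm invMg invgK.
by rewrite eigenvalue_root_char rE root_prod_XsubC.
Qed.

End MaximalIdeal.

(** * The spherical functions attached to a maximal ideal *)

Section SphericalOfIdeal.
Variables (R : realType) (I : Type) (G : I -> finGroupType).
Local Notation C := R[i].
Local Notation Gp := (restricted_prod G).
Local Notation J := {classic I}.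
Implicit Types (u v w g h : Gp -> C) (j : I).
Local Notation d := (@delta R Gp 1%g).
Variable K : set (Gp -> C).
Hypothesis maxK : maximal_ideal K.

(** The scalar to which [lift a] is congruent modulo [K]. For class functions it exists by
    [ideal_eigenvalue]; the default 0 applies when there is no such scalar. *)
Definition eigval j (a : G j -> C) : C := xget 0 [set z | K (lift a - z *: d)].

Section Coordinate.
Variable j : I.
Implicit Types (a b : G j -> C).

Definition is_class a := forall s t, a (s ^ t)%g = a s.

Lemma eigvalP a : is_class a -> K (lift a - eigval a *: d).
Proof.
move=> ca; rewrite /eigval; case: xgetP => [z -> //|no].
by have [z Kz _] := ideal_eigenvalue maxK ca; case: (no z).
Qed.

(** Two different scalars would put a nonzero multiple of the unit into [K]. *)
Lemma eigval_unique a z : is_class a -> K (lift a - z *: d) -> eigval a = z.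
Proof.
move=> ca Kz; apply: contrapT => /eqP nz; apply: (maximal_ideal_proper maxK).
have := idealZ maxK ((eigval a - z)^-1) (idealB maxK Kz (eigvalP ca)).
congr K; apply/funext => x; rewrite !fE.
rewrite -subr_eq0 in nz.
by field.
Qed.

Lemma eigvalD a b : is_class a -> is_class b ->
  eigval (fun s => a s + b s) = eigval a + eigval b.
Proof.
move=> ca cb; apply: eigval_unique => [s t|]; first by rewrite ca cb.
have := idealD maxK (eigvalP ca) (eigvalP cb); congr K; rewrite liftD.
by apply/funext => x; rewrite !fE; ring.
Qed.

Lemma eigvalZ c a : is_class a -> eigval (fun s => c * a s) = c * eigval a.
Proof.
move=> ca; apply: eigval_unique => [s t|]; first by rewrite ca.
have := idealZ maxK c (eigvalP ca); congr K; rewrite liftZ.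
by apply/funext => x; rewrite !fE; ring.
Qed.

Lemma eigval_sum (T : Type) (r : seq T) (P : pred T) (a : T -> G j -> C) :
  (forall i, is_class (a i)) ->
  eigval (fun s => \sum_(i <- r | P i) a i s) = \sum_(i <- r | P i) eigval (a i).
Proof.
move=> ca; elim: r => [|i r IH].
  rewrite big_nil; apply: eigval_unique => [s t|]; first by rewrite !big_nil.
  rewrite scale0r subr0 (_ : lift _ = 0); first exact: (ideal0 maxK).
  by rewrite /lift big1 // => s _; rewrite big_nil scale0r.
have cr : is_class (fun s => \sum_(i <- r | P i) a i s).
  by move=> s t; apply: eq_bigr => k _; rewrite ca.
rewrite big_cons; case: ifP => Pi; rewrite -IH -?eigvalD //; congr eigval;
  by apply/funext => s; rewrite big_cons Pi.
Qed.

Lemma eigval_conv a b : is_class a -> is_class b ->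
  eigval (fun z => \sum_s a s * b (s^-1 * z)%g) = eigval a * eigval b.
Proof.
move=> ca cb; apply: eigval_unique => [s t|].
  rewrite (reindex_inj (conjg_inj t)) /=; apply: eq_bigr => k _.
  by rewrite ca -conjVg -conjMg cb.
have za := lift_classfun ca; have zb := lift_classfun cb.
have [ea eb] := (Zell1_ell1 za, Zell1_ell1 zb).
have ed := @ell1_delta R Gp 1%g.
have := idealD maxK (ideal_convr maxK (eigvalP ca) zb) (idealZ maxK (eigval a) (eigvalP cb)).
rewrite convBl //; last exact: ell1Z.
rewrite convZl // conv1f -conv_lift_lift; congr K.
by apply/funext => x; rewrite !fE; ring.
Qed.

(** The uniform probability distribution on the conjugacy class of [y]; these span the class
    functions, by [class_avg_sum]. *)
Definition class_avg (y s : G j) : C := #|G j|%:R^-1 * \sum_t (y ^ t == s)%g%:R.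

Lemma class_avg_class y : is_class (class_avg y).
Proof.
move=> s t; rewrite /class_avg (reindex_inj (mulIg t)) /=; congr (_ * _).
by apply: eq_bigr => r _; rewrite conjgM (inj_eq (conjg_inj t)).
Qed.

Let n0 := cardH_neq0 R (G j).

Lemma class_avg_sum a : is_class a -> a = fun s => \sum_y a y * class_avg y s.
Proof.
move=> ca; apply/funext => s; rewrite /class_avg.
under eq_bigr do rewrite mulrCA; rewrite -mulr_sumr.
apply: (mulfI n0); rewrite mulVKf //.
under eq_bigr do rewrite mulr_sumr; rewrite exchange_big /=.
rewrite mulr_natl -sumr_const; apply: eq_bigr => t _.
rewrite (bigD1 (s ^ t^-1)%g) //= conjgKV eqxx mulr1 ca big1 ?addr0 // => y ys.
by rewrite -(inj_eq (conjg_inj t^-1%g)) conjgK (negPf ys) mulr0.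
Qed.

Lemma class_avg1 s : class_avg 1%g s = (s == 1%g)%:R.
Proof.
rewrite /class_avg; under eq_bigr do rewrite conj1g eq_sym.
by rewrite sumr_const -[X in _ * X]mulr_natl mulKf.
Qed.

Lemma class_avgV y s : class_avg y s^-1%g = class_avg y^-1%g s.
Proof.
rewrite /class_avg; congr (_ * _); apply: eq_bigr => t _.
by rewrite conjVg -(inj_eq invg_inj) invgK.
Qed.

Lemma class_avg_real y s : conjc (class_avg y s) = class_avg y s.
Proof.
rewrite /class_avg rmorphM fmorphV rmorph_nat rmorph_sum; congr (_ * _).
by apply: eq_bigr => t _; rewrite rmorph_nat.
Qed.

Definition sph_of y := eigval (class_avg y).

Lemma eigval_sph a : is_class a -> eigval a = \sum_y a y * sph_of y.
Proof.
move=> ca; rewrite {1}(class_avg_sum ca) eigval_sum => [|y s t].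
  by apply: eq_bigr => y _; rewrite eigvalZ //; exact: class_avg_class.
by rewrite class_avg_class.
Qed.

Lemma eigval_herm a : is_class a -> (forall s, a s^-1%g = conjc (a s)) ->
  conjc (eigval a) = eigval a.
Proof.
move=> ca ha; have [z Kz /(_ ha)] := ideal_eigenvalue maxK ca.
by rewrite (eigval_unique ca Kz).
Qed.

(** For [sphM]: the convolution of the distributions of [x] and [y] is the average over [t] of those
    of [x * y ^ t], and [eigval] is linear and multiplicative. *)
Lemma sph_of_spherical : spherical sph_of.
Proof.
split=> [|y|x y].
- apply: eigval_unique; first exact: class_avg_class.
  have -> : class_avg 1%g = fun s => (s == 1%g)%:R by apply/funext => s; exact: class_avg1.
  rewrite lift_delta emb1 scale1r subrr; exact: (ideal0 maxK).
- (* The Hermitian functions [class_avg y + class_avg y^-1] and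
     ['i * (class_avg y - class_avg y^-1)] have real eigenvalues. *)
  have cy := class_avg_class y; have cy' := class_avg_class y^-1%g.
  have cD : is_class (fun s => class_avg y s + class_avg y^-1%g s).
    by move=> s t; rewrite cy cy'.
  have cB : is_class (fun s => 'i%C * (class_avg y s + -1 * class_avg y^-1%g s)).
    by move=> s t; rewrite cy cy'.
  have cjM (a b : C) : conjc (a * b) = conjc a * conjc b by exact: (rmorphM conjc).
  have cjD (a b : C) : conjc (a + b) = conjc a + conjc b by exact: (rmorphD conjc).
  have cjN1 : conjc (-1 : C) = -1 by apply: (etrans (rmorphN conjc 1)); rewrite rmorph1.
  have cji : conjc ('i%C : C) = - 'i%C by apply/eqP; rewrite eq_complex /= oppr0 !eqxx.
  have cjB (a b : C) : conjc ('i%C * (a + -1 * b)) = - 'i%C * (conjc a + -1 * conjc b).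
    by rewrite cjM cji cjD cjM cjN1.
  have := eigval_herm cD; rewrite eigvalD // => /(_ _)/wrap[|re].
    by move=> s; rewrite !class_avgV invgK cjD !class_avg_real addrC.
  have cN : is_class (fun s => -1 * class_avg y^-1%g s) by move=> s t; rewrite cy'.
  have EB : eigval (fun s => 'i%C * (class_avg y s + -1 * class_avg y^-1%g s)) =
      'i%C * (sph_of y + -1 * sph_of y^-1%g).
    rewrite (@eigvalZ _ (fun s => class_avg y s + -1 * class_avg y^-1%g s)) => [|s t];
      last by rewrite cy cy'.
    by rewrite (@eigvalD _ (fun s => -1 * class_avg y^-1%g s)) // (@eigvalZ _ (class_avg y^-1%g)).
  have := eigval_herm cB; rewrite EB.
  move=> /(_ _)/wrap[s|im].
    by rewrite !class_avgV invgK cjB !class_avg_real; ring.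
  rewrite cjB in im; rewrite cjD in re.
  move: re im; rewrite -/(sph_of y) -/(sph_of y^-1%g).
  move: (sph_of y) (sph_of y^-1%g) => a b re im.
  have i0 : 'i%C != 0 :> C by rewrite eq_complex /= oner_eq0 andbF.
  have im' : conjc b - conjc a = a - b.
    by apply: (mulfI i0); move: im; rewrite !mulN1r => <-; ring.
  have two : 2 != 0 :> C by rewrite pnatr_eq0.
  apply: (mulfI two).
  have -> : 2 * b = (a + b) - (a - b) by ring.
  by rewrite -re -im'; ring.
- transitivity (eigval (fun s => \sum_t class_avg (x * y ^ t)%g s)).
    by rewrite eigval_sum // => t s r; rewrite class_avg_class.
  have -> : (fun s => \sum_t class_avg (x * y ^ t)%g s) =
    fun s => #|G j|%:R * \sum_r class_avg x r * class_avg y (r^-1 * s)%g.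
    apply/funext => s; rewrite /class_avg.
    transitivity (#|G j|%:R^-1 * \sum_r \sum_t ((x ^ r * y ^ t)%g == s)%:R : C).
      rewrite -mulr_sumr exchange_big; congr (_ * _); apply: eq_bigr => r _.
      rewrite [RHS](reindex_inj (mulIg r)) /=; apply: eq_bigr => t _.
      by rewrite conjMg conjgM.
    transitivity (#|G j|%:R * (#|G j|%:R^-1 * #|G j|%:R^-1) *
      \sum_z (\sum_r (x ^ r == z)%g%:R) * (\sum_t (y ^ t == z^-1 * s)%g%:R) : C); last first.
      by rewrite -mulrA mulr_sumr; congr (_ * _); apply: eq_bigr => z _; ring.
    rewrite mulVKf //; congr (_ * _).
    under [RHS]eq_bigr do rewrite mulr_suml; rewrite [RHS]exchange_big /=.
    apply: eq_bigr => r _; rewrite [RHS](bigD1 (x ^ r)%g) //= eqxx mul1r.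
    rewrite [X in _ + X]big1 ?addr0 => [|z zx]; last by rewrite eq_sym (negPf zx) mul0r.
    apply: eq_bigr => t _; congr (nat_of_bool _)%:R.
    by rewrite -[in RHS](inj_eq (mulgI (x ^ r)%g)) mulKVg.
  have cx := class_avg_class x; have cy := class_avg_class y.
  rewrite eigvalZ ?eigval_conv // => s t.
  rewrite (reindex_inj (conjg_inj t)) /=; apply: eq_bigr => k _.
  by rewrite cx -conjVg -conjMg cy.
Qed.

End Coordinate.

(** By [eigval_sph], the scalar of the idempotent is its pairing with the spherical function, which
    is 1 by [sum_idem]. *)
Lemma idem_ideal j : K (lift (@idem R I G sph_of j) - d).
Proof.
have sf i := @sph_of_spherical i.
have ci : is_class (@idem R I G sph_of j) by move=> s t; rewrite (idemJ sf).
have := eigvalP ci; rewrite eigval_sph //.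
rewrite (_ : \sum_y _ = 1) ?scale1r //.
by rewrite -[RHS](sum_idem sf j); apply: eq_bigr => t _; rewrite mulrC.
Qed.

End SphericalOfIdeal.

(** * Approximate identities when the products of norms are bounded *)

Section BoundedApproximateIdentity.
Variables (R : realType) (I : Type) (G : I -> finGroupType).
Local Notation C := R[i].
Local Notation Gp := (restricted_prod G).
Local Notation J := {classic I}.
Implicit Types (u v w g h : Gp -> C) (j : I) (S : {fset J}).
Local Notation d := (@delta R Gp 1%g).
Variables (K : set (Gp -> C)) (M : R).
Hypothesis maxK : maximal_ideal K.
Local Notation f := (sph_of K).
Hypothesis fM : forall S, \prod_(j <- S) sph_norm (f (j := j)) <= M.

Let sf j : spherical (f (j := j)) := sph_of_spherical maxK j.

Let ff : forall j, G j -> C := fun j => f (j := j).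

Let zd : Zell1 d := @Zell1_1 R Gp.

Let zE (S : seq J) : Zell1 (conv_idems ff S d).
Proof. exact: Zell1_conv_idems. Qed.

Let KE (S : seq J) : K (conv_idems ff S d - d).
Proof.
elim: S => [|j S IH] /=; first by rewrite subrr; exact: (ideal0 maxK).
have eS := Zell1_ell1 (zE S).
have eI := ell1_lift (idem ff (j := j)).
have := idealD maxK (ideal_convl maxK (zE S) (idem_ideal maxK j)) IH.
congr K; rewrite convBr ?convf1 ?conv_lift_idem //; last exact: ell1_delta.
by rewrite addrA subrK.
Qed.

Let M0 : 0 <= M.
Proof. by apply: le_trans (fM fset0); rewrite big_seq_fset0 ler01. Qed.

Let nrm_le S u : ell1 u -> nrm (conv_idems ff S u) <= M * nrm u.
Proof.
move=> eu; apply: le_trans (nrm_conv_idems sf S eu) _.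
by rewrite ler_wpM2r ?nrm_ge0 // fM.
Qed.

Let nrm_E S : nrm (conv_idems ff S d) <= M.
Proof.
apply: le_trans (nrm_le S (Zell1_ell1 zd)) _.
by rewrite ler_piMr // nrm_delta.
Qed.

(** Let [E] be the product of the idempotents in [S], and [g = g1 + g2] with [g1] supported in [S].
    Then [E * g = phi(g1) E + E * g2] lies in [K] and [E] is congruent to [d], so [d - r] is in [K]
    for [r = - phi(g1)^-1 E * g2]. If [phi g] were nonzero, a small [g2] would make [d - r]
    invertible. *)
Lemma phi_vanishes g : K g -> phi ff g = 0.
Proof.
move=> Kg; apply: contrapT => /eqP pg; apply: (maximal_ideal_proper maxK).
have zg := ideal_Zell1 maxK Kg; have eg := Zell1_ell1 zg.
have p0 : 0 < normc (phi ff g) by rewrite lt0r normc_eq0 pg normc_ge0.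
pose e := normc (phi ff g) / (2 * (M + 1)).
(* With [g2] of norm at most [|phi g| / (2 * (M + 1))], the value [|phi g1|] stays above
   [M * nrm g2], which bounds the norm of [E * g2]. *)
have M1 : 0 < 2 * (M + 1) by rewrite mulr_gt0 // ltr_wpDl.
have [S HS] := restrict_approx eg (divr_gt0 p0 M1).
have {}HS := HS S (fsubset_refl _).
have z1 := Zell1_restrict S zg.
have S1 : supported_in S (restrict S g) by exact: restrict_supported.
have gE : g = restrict S g + (g - restrict S g) by rewrite addrC subrK.
have z2 : Zell1 (g - restrict S g) by exact: Zell1B.
move: (restrict S g) (g - restrict S g) z1 z2 S1 HS gE => g1 g2 z1 z2 S1 HS gE.
have [e1 e2] := (Zell1_ell1 z1, Zell1_ell1 z2).
have pE : phi ff g1 = phi ff g - phi ff g2 by rewrite gE phiD // addrK.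
have eS := Zell1_ell1 (zE S).
have zr2 : Zell1 (conv_idems ff S g2) by exact: Zell1_conv_idems.
have p2 : normc (phi ff g2) <= nrm g2 by exact: normc_phi.
have He : nrm g2 * (2 * (M + 1)) <= normc (phi ff g) by rewrite -ler_pdivlMr.
have g20 := nrm_ge0 g2.
have p1 : nrm g2 * M < normc (phi ff g1).
  have : normc (phi ff g) <= normc (phi ff g1) + normc (phi ff g2).
    by rewrite -[phi ff g](subrK (phi ff g2)) -pE ler_normcD.
  nra.
have p1n : 0 < normc (phi ff g1) by apply: le_lt_trans p1; rewrite mulr_ge0.
have p1n0 : phi ff g1 != 0 by rewrite -normc_eq0 gt_eqF.
pose r := (- (phi ff g1)^-1) *: conv_idems ff S g2.
have zr : Zell1 r by exact: Zell1Z.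
have r1 : nrm r < 1.
  apply: le_lt_trans (nrmZ _ (Zell1_ell1 zr2)) _.
  rewrite normcN normcV mulrC ltr_pdivrMr // mul1r; apply: le_lt_trans p1.
  by rewrite mulrC; apply: nrm_le.
have Kr : K (d - r).
  have KS : K (conv_idems ff S g).
    by rewrite conv_idems_delta //; apply: (ideal_convr maxK).
  have := idealZ maxK (phi ff g1)^-1 (idealB maxK KS (idealZ maxK (phi ff g1) (KE S))).
  congr K; rewrite {1}gE conv_idemsD (conv_idems_supported sf z1 S1) /r.
  by apply/funext => x; rewrite !fE; field.
have [v zv vE] := neumann_series zr r1.
have er := Zell1_ell1 zr; have ev := Zell1_ell1 zv; have ed := Zell1_ell1 zd.
rewrite -vE -(convf1 v); have [_ cr] := zr; rewrite {2}(convf1 v) cr //.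
rewrite -convBr //; exact: (ideal_convl maxK).
Qed.

(** The error of [d - E] at [g] is [- E * g]. Splitting [g = g1 + g2] as before, [phi g = 0] gives
    [phi g1 = - phi g2], so the error is at most [2 * M * nrm g2]. *)
Lemma maximal_ideal_bai : has_bai_of_norm_le (1 + M) K.
Proof.
exists {fset J}, (fun S S' => (S `<=` S')%fset), (fun S => d - conv_idems ff S d).
have KdE (S : {fset J}) : K (d - conv_idems ff S d).
  by rewrite -opprB -scaleN1r; apply: (idealZ maxK); exact: KE.
split; first split.
- split=> [|S|S1 S2 S3|S1 S2].
  + exact: (inhabits fset0).
  + exact: fsubset_refl.
  + exact: fsubset_trans.
  + by exists (S1 `|` S2)%fset; rewrite fsubsetUl fsubsetUr.
- exact: KdE.
- move=> g Kg e e0.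
  have zg := ideal_Zell1 maxK Kg; have eg := Zell1_ell1 zg.
  have M2 : 0 < 2 * M + 1 by rewrite ltr_wpDl // mulr_ge0.
  (* Halving [e] turns the weak inequality of [restrict_approx] into the strict one demanded of an
     approximate identity. *)
  have e20 : 0 < e / 2 by rewrite divr_gt0.
  have [S HS] := restrict_approx eg (divr_gt0 e20 M2).
  exists S => S' /HS {}HS.
  have eE := Zell1_ell1 (zE S'); have ed := Zell1_ell1 zd.
  have -> : (fun x => convolution (d - conv_idems ff S' d) g x - g x) = - conv_idems ff S' g.
    rewrite -[LHS]/(convolution (d - conv_idems ff S' d) g - g).
    rewrite convBl // conv1f (conv_idems_delta sf _ eg).
    have [_ ->] := zE S'; last exact: eg.
    by apply/funext => x; rewrite !fE; ring.
  have eSg : ell1 (conv_idems ff S' g) by exact: ell1_conv_idems.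
  rewrite ell1_normE; last exact: ell1N.
  rewrite lte_fin nrmN; apply: (@le_lt_trans _ _ (e / 2)); last first.
    by rewrite ltr_pdivrMr // ltr_pMr // ltr1n.
  have z1 := Zell1_restrict S' zg.
  have S1 : supported_in S' (restrict S' g) by exact: restrict_supported.
  have gE : g = restrict S' g + (g - restrict S' g) by rewrite addrC subrK.
  have z2 : Zell1 (g - restrict S' g) by exact: Zell1B.
  move: (restrict S' g) (g - restrict S' g) z1 z2 S1 HS gE => g1 g2 z1 z2 S1 HS gE.
  have [e1 e2] := (Zell1_ell1 z1, Zell1_ell1 z2).
  have p12 : phi ff g1 = - phi ff g2.
    by apply/eqP; rewrite -addr_eq0 -phiD // -gE phi_vanishes.
  rewrite gE conv_idemsD (conv_idems_supported sf z1 S1) p12.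
  have le1 : nrm (- phi ff g2 *: conv_idems ff S' d) <= nrm g2 * M.
    apply: le_trans (nrmZ _ eE) _; rewrite normcN ler_pM ?normc_ge0 ?nrm_ge0 //.
    exact: normc_phi.
  have le2 := nrm_le S' e2.
  apply: le_trans (nrmD _ _) _; [exact: ell1Z | exact: ell1_conv_idems |].
  move: HS; rewrite ler_pdivlMr // => HS.
  have := nrm_ge0 g2; move: le1 le2 HS; lra.
apply: ge_ereal_sup => _ [S _ <-].
have ed := Zell1_ell1 zd; have eE := Zell1_ell1 (zE S).
rewrite ell1_normE; last exact: ell1B.
rewrite lee_fin (le_trans (nrmB _ _)) // lerD //; exact: nrm_delta.
Qed.

End BoundedApproximateIdentity.

Lemma sph_norm_ge1 (R : realType) (H : finGroupType) (f : H -> R[i]) :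
  spherical f -> 1 <= sph_norm f.
Proof.
move=> sf; rewrite /sph_norm mulrC ler_pdivlMr ?sph_sq_gt0 // mul1r.
apply: ler_sum => x _; rewrite expr2 ler_piMl ?normc_ge0 //; exact: sph_le1.
Qed.

Lemma sph_norm_le_card (R : realType) (H : finGroupType) (f : H -> R[i]) :
  spherical f -> sph_norm f <= #|H|%:R.
Proof.
move=> sf; rewrite /sph_norm mulrC ler_pdivrMr ?sph_sq_gt0 //.
apply: (@le_trans _ _ #|H|%:R); last by rewrite ler_peMr ?sph_sq_ge1.
by rewrite -sumr_const; apply: ler_sum => x _; exact: sph_le1.
Qed.

Lemma bernoulli_prod (R : realDomainType) (T : eqType) (s : seq T) (F : T -> R) (e : R) :
  0 <= e -> (forall i, i \in s -> 1 + e <= F i) ->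
  1 + e * (size s)%:R <= \prod_(i <- s) F i.
Proof.
move=> e0; elim: s => [|i s IH] sF; first by rewrite big_nil mulr0 addr0.
have i1 := sF i (mem_head _ _).
have {}IH : 1 + e * (size s)%:R <= \prod_(k <- s) F k.
  by apply: IH => k ks; apply: sF; rewrite inE ks orbT.
rewrite big_cons /= -natr1.
have a0 := ler0n R (size s).
apply: le_trans (ler_pM _ _ i1 IH); last 2 first.
- by rewrite addr_ge0.
- by rewrite addr_ge0 // mulr_ge0.
by move: (size s)%:R a0 => a a0; nra.
Qed.

(** * Finitely many exceptional factors and the equivalence *)

Section Main.
Variables (R : realType) (I : Type) (G : I -> finGroupType).
Local Notation C := R[i].
Local Notation Gp := (restricted_prod G).
Local Notation J := {classic I}.

Definition norm1_idempotents (i : I) : Prop :=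
  forall chi : G i -> C, irreducible_character chi ->
    chi 1%g * (\sum_(x : G i) `|chi x|) = #|G i|%:R.

Lemma finite_exceptions :
  (forall K : set (Gp -> C), maximal_ideal K -> has_bai K) ->
  finite_set [set i | ~ norm1_idempotents i].
Proof.
move=> baiK; apply: contrapT => inf.
have large i : exists f : G i -> C, spherical f /\
    (~ norm1_idempotents i -> 1 + 1024^-1 <= sph_norm f).
  have [n1|nn1] := pselect (norm1_idempotents i).
    (* At the unexceptional indices the trivial character completes the family. *)
    exists (fun=> 1); split=> //; split=> [//|x|x y]; first by rewrite conjc1.
    by rewrite sumr_const !mulr1.
  have [chi [irr nE]] : exists chi : G i -> C, irreducible_character chi /\
      chi 1%g * (\sum_(x : G i) `|chi x|) <> #|G i|%:R.
    apply: contrapT => no; apply: nn1 => chi irr; apply: contrapT => nE.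
    by apply: no; exists chi.
  have [f [sf _ iffE]] := irreducible_character_spherical irr.
  exists f; split=> // _; rewrite leNgt; apply/negP => /(sph_gap sf) f1.
  by apply: nE; apply/iffE.
pose f i := sval (cid (large i)).
have sf i : spherical (f i) by have [] := svalP (cid (large i)).
have lf i : ~ norm1_idempotents i -> 1 + 1024^-1 <= sph_norm (f i).
  by have [] := svalP (cid (large i)).
have [M HM] := kernel_bai_bound sf (baiK _ (phi_kernel_maximal sf)).
have growth (s : seq J) (sbad : forall i, i \in s -> ~ norm1_idempotents i) :
    1 + 1024^-1 * (size s)%:R <= \prod_(i <- s) sph_norm (f i).
  by apply: bernoulli_prod => [|i /sbad /lf //]; lra.
(* More than [1024 * M] exceptional indices, each contributing a factor at least [1 + 1024^-1], push
   the product above [M] by Bernoulli's inequality. *)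
have [B Bbad nB] := @infinite_set_fset J _ (Num.bound (1024 * M)) inf.
have := HM B (fset_uniq B); have /growth := Bbad.
have := unstable.ltr_bound (1024 * M).
have : (Num.bound (1024 * M))%:R <= (size B)%:R :> R by rewrite ler_nat.
by move: (\prod_(_ <- _) _) => c; lra.
Qed.

(** Outside [F] all idempotents have norm 1, and on [F] the norm is at most [#|G i|]; so the
    products over all finite [S] share the bound [M]. *)
Lemma uniform_bai : finite_set [set i | ~ norm1_idempotents i] ->
  exists2 M : R, 0 < M &
    forall K : set (Gp -> C), maximal_ideal K -> has_bai_of_norm_le M K.
Proof.
move=> finF; pose F : {fset J} := fset_set [set i : J | ~ norm1_idempotents i].
have F1 i : (i : J) \notin F -> norm1_idempotents i.
  move=> iF; apply: contrapT => ni; case/negP: iF.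
  by rewrite /F in_fset_set //; apply: mem_set.
pose M : R := \prod_(i <- F) #|G i|%:R.
have c1 i : 1 <= #|G i|%:R :> R by rewrite ler1n; apply/card_gt0P; exists 1%g.
exists (1 + M); first by rewrite ltr_pwDl // prodr_ge0.
move=> K maxK; apply: maximal_ideal_bai => // S.
have sf j := sph_of_spherical maxK j.
have s0 j : 0 <= sph_norm (sph_of K (j := j)).
  by apply: le_trans (sph_norm_ge1 (sf j)); rewrite ler01.
rewrite (big_fsetID _ (mem F)) /= [X in _ * X]big1_seq ?mulr1; last first.
  move=> j; rewrite !inE => /andP[_ /andP[_ jF]].
  exact: (spherical_sph_norm (sf j) (F1 j jF)).
(* The indices of [F] outside [S] contribute factors that are at least 1 to the bound. *)
rewrite /M (big_fsetID _ (mem S) F) /=.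
rewrite (_ : [fset x in S | x \in F]%fset = [fset x in F | x \in S]%fset); last first.
  by apply/fsetP => x; rewrite !inE andbC.
rewrite -[leLHS]mulr1; apply: ler_pM => //.
- exact: prodr_ge0.
- by apply: ler_prod => j _; rewrite s0 sph_norm_le_card.
- by elim/big_rec: _ => [|j x _ x1]; rewrite ?lexx // -[leLHS]mulr1; apply: ler_pM.
Qed.

End Main.

Theorem theorem4p3 (R : realType) (I : Type) (G : I -> finGroupType) :
  [<-> forall J : set (restricted_prod G -> R[i]),
         maximal_ideal J -> has_bai J;
       exists2 F : set I, finite_set F &
         forall i : I, ~ F i ->
         forall chi : G i -> R[i], irreducible_character chi ->
           chi 1%g * (\sum_(x : G i) `|chi x|) = #|G i|%:R;
       exists2 M : R, 0 < M &
         forall J : set (restricted_prod G -> R[i]),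
           maximal_ideal J -> has_bai_of_norm_le M J].
Proof.
split; [|split].
- move=> baiJ; exists [set i | ~ norm1_idempotents R G i]; first exact: finite_exceptions.
  by move=> i /contrapT.
- move=> [F finF F1]; apply: uniform_bai; apply: sub_finite_set finF => i ni.
  by apply: contrapT => Fi; apply: ni; exact: F1.
- move=> [M M0 baiM] J /baiM[A [le [h [aih nhM]]]]; exists A, le, h; split=> //.
  exact: le_lt_trans nhM (ltry M).
Qed.
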